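(* Let $K \in \mathcal{K}^n$. Then $$\max\left\{s(K)\sqrt{\frac{n+1}{2n}},\frac{s(K)+1}{2}\right\} \le \min_{A \in GL_n(\mathbb{R})}\frac{D(AK)}{2r(AK)} \le \begin{cases}\frac{D_{s_J(K)}}{2}, & \text{if } n=2,\\[4pt] \sqrt{\frac{n(s_J(K)+1)}{2}}, & \text{else}.\end{cases}$$ The lower bound is tight for any prescribed $s(K) \in [1,n]$ (i.e., for every $s \in [1,n]$ there is $K \in \mathcal{K}^n$ with $s(K) = s$ attaining equality in the lower bound). The upper bound is tight for $s_J(K) \in \{1,n\}$ (i.e., for each $s \in \{1,n\}$ there is $K \in \mathcal{K}^n$ with $s_J(K)=s$ attaining equality in the upper bound).
   Context: $\mathcal{K}^n$ is the family of convex bodies in $\mathbb{R}^n$, i.e., compact convex sets with non-empty interior. $D(K)$ is the Euclidean diameter and $r(K)$ the Euclidean inradius (largest radius of a Euclidean ball contained in $K$). The Minkowski asymmetry $s(K)$ is the smallest $\rho \ge 0$ such that some translate of $-K$ is contained in $\rho K$; it takes values in $[1,n]$. The John ellipsoid $\mathcal{E}_J(K)$ is the (unique) volume-maximal $n$-dimensional ellipsoid contained in $K$, with center $c_J(K)$, and the John asymmetry is $s_J(K) = \inf\{\rho \ge 0 : K - c_J(K) \subset \rho\,(c_J(K)-K)\}$, which takes values in $[1,n]$. For $s \in [1,2]$, $D_s = \sqrt{s^2 + 5 + \sqrt{4(2-s)^2 + (s^2-1)^2}}$. *)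

(* Defs.v *)
From mathcomp Require Import all_boot all_order all_algebra.
From mathcomp Require Import all_classical all_reals all_analysis.

Set Implicit Arguments.
Unset Strict Implicit.
Unset Printing Implicit Defensive.

Import Order.TTheory GRing.Theory Num.Theory.
Import numFieldNormedType.Exports.

Local Open Scope classical_set_scope.
Local Open Scope ring_scope.

(* The library norm on matrices is the sup norm (it induces the usual topology
   of R^n), so the Euclidean norm is introduced separately. *)
Definition enorm (R : realType) (n : nat) (x : 'cV[R]_n) : R :=
  Num.sqrt (\sum_(i < n) x i 0 ^+ 2).

Definition eball (R : realType) (n : nat) (c : 'cV[R]_n) (r : R) :
    set 'cV[R]_n :=
  [set x | enorm (x - c) <= r].

Definition convex_body (R : realType) (n : nat) (K : set 'cV[R]_n) : Prop :=
  [/\ compact K, convex_set K & interior K !=set0].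

Definition diameter (R : realType) (n : nat) (K : set 'cV[R]_n) : R :=
  sup [set d | exists x y, [/\ K x, K y & d = enorm (x - y)]].

Definition inradius (R : realType) (n : nat) (K : set 'cV[R]_n) : R :=
  sup [set r | 0 <= r /\ exists c, eball c r `<=` K].

Definition minkowski_asymmetry (R : realType) (n : nat)
    (K : set 'cV[R]_n) : R :=
  inf [set rho | 0 <= rho /\
    exists t, [set - x + t | x in K] `<=` [set rho *: x | x in K]].

(* n-dimensional volume.  On Borel sets this is the n-fold product of the
   one-dimensional Lebesgue measure: the recursive clause is the definition of
   the product measure, i.e. the integral over x of the volume of the section
   of A at first coordinate x. *)
Fixpoint volume (R : realType) (n : nat) : set 'cV[R]_n -> \bar R :=
  match n with
  | 0 => fun A => (\1_A 0)%:E
  | m.+1 => fun A =>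
      (\int[@lebesgue_measure R]_(x in setT)
         volume [set y : 'cV[R]_m | A (col_mx x%:M y)])%E
  end.

Definition ellipsoid (R : realType) (n : nat) (c : 'cV[R]_n) (A : 'M[R]_n) :
    set 'cV[R]_n :=
  [set c + A *m x | x in eball 0 1].

Definition is_ellipsoid (R : realType) (n : nat) (E : set 'cV[R]_n) : Prop :=
  exists c A, A \in unitmx /\ E = ellipsoid c A.

Definition is_john_ellipsoid (R : realType) (n : nat)
    (K E : set 'cV[R]_n) : Prop :=
  [/\ is_ellipsoid E, E `<=` K &
      forall F, is_ellipsoid F -> F `<=` K -> (volume F <= volume E)%E].

(* [xget] picks an element of a set; the set is a singleton here when K is a
   convex body (existence and uniqueness of the John ellipsoid). *)
Definition john_ellipsoid (R : realType) (n : nat) (K : set 'cV[R]_n) :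
    set 'cV[R]_n :=
  xget set0 [set E | is_john_ellipsoid K E].

Definition ellipsoid_center (R : realType) (n : nat) (E : set 'cV[R]_n) :
    'cV[R]_n :=
  xget 0 [set c | exists A, A \in unitmx /\ E = ellipsoid c A].

Definition john_center (R : realType) (n : nat) (K : set 'cV[R]_n) :
    'cV[R]_n :=
  ellipsoid_center (john_ellipsoid K).

Definition john_asymmetry (R : realType) (n : nat) (K : set 'cV[R]_n) : R :=
  let c := john_center K in
  inf [set rho | 0 <= rho /\
    [set x - c | x in K] `<=` [set rho *: (c - x) | x in K]].

Definition lin_image (R : realType) (n : nat) (A : 'M[R]_n)
    (K : set 'cV[R]_n) : set 'cV[R]_n :=
  [set A *m x | x in K].

Definition diam_inradius_ratios (R : realType) (n : nat) (K : set 'cV[R]_n) :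
    set R :=
  [set diameter (lin_image A K) / (2 * inradius (lin_image A K))
    | A in [set A : 'M[R]_n | A \in unitmx]].

Definition is_minimum (R : realType) (S : set R) (m : R) : Prop :=
  S m /\ lbound S m.

Definition lower_bound (R : realType) (n : nat) (s : R) : R :=
  Num.max (s * Num.sqrt ((n%:R + 1) / (2 * n%:R))) ((s + 1) / 2).

Definition Dconst (R : realType) (s : R) : R :=
  Num.sqrt (s ^+ 2 + 5 + Num.sqrt (4 * (2 - s) ^+ 2 + (s ^+ 2 - 1) ^+ 2)).

Definition upper_bound (R : realType) (n : nat) (s : R) : R :=
  if n == 2%N then Dconst s / 2 else Num.sqrt (n%:R * (s + 1) / 2).

(* Main.v *)
Require Import Defs.
From mathcomp Require Import all_boot all_order all_algebra finmap.
From mathcomp Require Import all_classical all_reals all_analysis.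
From mathcomp Require Import measurable_realfun ring lra.

(** Lower bound.  Let [K] be a convex body and [A] invertible, and let [A K]
    contain a ball of radius [r].  If [A K] lies in a ball of radius [r'], then a
    translate of [- K] lies in [(r' / r) K], so that the Minkowski asymmetry [s]
    is at most [r' / r] ([mink_enclosed]).  Jung's theorem ([jung]) gives
    [r' <= D sqrt (n / (2 (n + 1)))] and an elementary argument
    ([mink_diameter]) gives [r' <= D s / (s + 1)], where [D] is the diameter of
    [A K].  These are the two terms of the bound ([ratio_ge_lower_bound]).  The
    minimum over [A] exists by compactness ([ratio_min_exists]).  For the
    convex hull of the unit ball and a regular simplex of circumradius [s] the
    identity matrix attains the lower bound ([tight_lower_body]).

    Upper bound.  The iterated integral gives an ellipsoid with matrix [A] the
    volume [|det A|] times that of the unit ball ([ellipsoid_volumeS]), so that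
    a maximal ellipsoid exists, and after an affine map it is the unit ball.  The
    inradius is then at least one, and the diameter remains to be bounded.
    John's theorem enters in a dual form ([john_position_dual]): if
    [<z, u> <= al] and [<w, u> <= be] at all contact points [u] of [K] with the
    unit sphere, then [n al be + <z, w> >= 0].  Contact points satisfy
    [- s <= <x, u> <= 1] for [x] in [K], where [s] is the John asymmetry, and
    three applications of the dual form give
    [|x - y| ^ 2 <= 2 n (s + 1)] ([john_position_diam]).

    In the plane one coordinate of a contact point determines the other up to
    sign, and more is true ([john_position_diam2]).  Put the second axis along
    [x - y] and let [m] be the midpoint and [t] half the length of the segment,
    with [K] in the coordinates where the John ellipsoid is the unit ball.  The dual
    form applied to [x] and [y] gives [t ^ 2 <= 2 + |m| ^ 2], so a long segment
    must be far from the origin; but the contact points satisfy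
    [t |u_2| <= (s + 1) / 2], and this allows the segment, or one end point of
    it, to be moved to a position where the dual form fails unless
    [2 t <= Dconst s] ([planar_core]).

    The upper bound is attained by the cube when [s = 1]: its John ellipsoid is
    centred by symmetry, and the columns of [A] and the rows of its inverse
    bound the ratio from below ([cube_ball_diameter]).  When [s = n] both bounds
    coincide ([upper_lower_dim]), and the body attaining the lower bound with
    Minkowski asymmetry [n] has John asymmetry [n], since the John asymmetry
    lies between the Minkowski asymmetry and [n]. *)

Set Implicit Arguments.
Unset Strict Implicit.
Unset Printing Implicit Defensive.

Import Order.TTheory GRing.Theory Num.Theory.
Import numFieldNormedType.Exports.

Local Open Scope classical_set_scope.
Local Open Scope ring_scope.

(** * Euclidean inner product *)

Definition dot (R : realType) n (x y : 'cV[R]_n) : R :=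
  \sum_(i < n) x i 0 * y i 0.

Section Dot.
Context {R : realType} {n : nat}.
Implicit Types (x y z : 'cV[R]_n) (a b : R).

Lemma dotC x y : dot x y = dot y x.
Proof. by apply: eq_bigr => i _; rewrite mulrC. Qed.

Lemma dotDl x y z : dot (x + y) z = dot x z + dot y z.
Proof. by rewrite -big_split; apply: eq_bigr => i _; rewrite mxE mulrDl. Qed.

Lemma dotDr x y z : dot z (x + y) = dot z x + dot z y.
Proof. by rewrite dotC dotDl !(dotC z). Qed.

Lemma dotZl a x y : dot (a *: x) y = a * dot x y.
Proof. by rewrite mulr_sumr; apply: eq_bigr => i _; rewrite mxE mulrA. Qed.

Lemma dotZr a x y : dot x (a *: y) = a * dot x y.
Proof. by rewrite dotC dotZl dotC. Qed.

Lemma dotNl x y : dot (- x) y = - dot x y.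
Proof. by rewrite -scaleN1r dotZl mulN1r. Qed.

Lemma dotNr x y : dot x (- y) = - dot x y.
Proof. by rewrite dotC dotNl dotC. Qed.

Lemma dot0l x : dot 0 x = 0.
Proof. by rewrite -(scale0r x) dotZl mul0r. Qed.

Lemma dot0r x : dot x 0 = 0.
Proof. by rewrite dotC dot0l. Qed.

Definition dotE := (dotDl, dotDr, dotNl, dotNr, dotZl, dotZr, dot0l, dot0r).

Lemma dot_suml I (r : seq I) (P : pred I) (F : I -> 'cV[R]_n) y :
  dot (\sum_(i <- r | P i) F i) y = \sum_(i <- r | P i) dot (F i) y.
Proof.
by elim/big_rec2: _ => [|i u v _ <-]; rewrite ?dot0l ?dotDl.
Qed.

Lemma dot_sumr I (r : seq I) (P : pred I) (F : I -> 'cV[R]_n) y :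
  dot y (\sum_(i <- r | P i) F i) = \sum_(i <- r | P i) dot y (F i).
Proof. by rewrite dotC dot_suml; apply: eq_bigr => i _; rewrite dotC. Qed.

Lemma dot_ge0 x : 0 <= dot x x.
Proof. by apply: sumr_ge0 => i _; rewrite -expr2 sqr_ge0. Qed.

Lemma dot_eq0 x : (dot x x == 0) = (x == 0).
Proof.
apply/eqP/eqP => [x0|->]; last by rewrite dot0l.
apply/matrixP => i j; rewrite ord1 mxE.
move/eqP: x0; rewrite psumr_eq0; last by move=> k _; rewrite -expr2 sqr_ge0.
by move/allP/(_ i (mem_index_enum _)); rewrite /= mulf_eq0 orbb => /eqP.
Qed.

Lemma dot_gt0 x : (0 < dot x x) = (x != 0).
Proof. by rewrite lt_def dot_eq0 dot_ge0 andbT. Qed.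

Lemma enormE x : enorm x = Num.sqrt (dot x x).
Proof. by congr Num.sqrt; apply: eq_bigr => i _; rewrite expr2. Qed.

Lemma enorm_ge0 x : 0 <= enorm x.
Proof. exact: sqrtr_ge0. Qed.

Lemma enorm_sq x : enorm x ^+ 2 = dot x x.
Proof. by rewrite enormE sqr_sqrtr// dot_ge0. Qed.

Lemma enorm_le x a : 0 <= a -> (enorm x <= a) = (dot x x <= a ^+ 2).
Proof. by move=> a0; rewrite -enorm_sq ler_sqr ?nnegrE ?enorm_ge0. Qed.

Lemma enorm_eq0 x : (enorm x == 0) = (x == 0).
Proof. by rewrite enormE sqrtr_eq0 le_eqVlt ltNge dot_ge0 orbF dot_eq0. Qed.

Lemma enorm0 : enorm (0 : 'cV[R]_n) = 0.
Proof. by apply/eqP; rewrite enorm_eq0. Qed.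

Lemma enorm_gt0 x : (0 < enorm x) = (x != 0).
Proof. by rewrite lt_def enorm_eq0 enorm_ge0 andbT. Qed.

Lemma enormN x : enorm (- x) = enorm x.
Proof. by rewrite !enormE !dotE opprK. Qed.

Lemma enormB x y : enorm (x - y) = enorm (y - x).
Proof. by rewrite -enormN opprB. Qed.

Lemma enormZ a x : enorm (a *: x) = `|a| * enorm x.
Proof. by rewrite !enormE !dotE mulrA -expr2 sqrtrM ?sqr_ge0// sqrtr_sqr. Qed.

Lemma dot_sqr_le x y : dot x y ^+ 2 <= dot x x * dot y y.
Proof.
have [->|x0] := eqVneq x 0; first by rewrite !dotE expr0n mul0r.
have := dot_ge0 (dot x x *: y - dot x y *: x).
have -> : dot (dot x x *: y - dot x y *: x) (dot x x *: y - dot x y *: x)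
   = dot x x * (dot x x * dot y y - dot x y ^+ 2).
  by rewrite !dotE (dotC y x); ring.
by rewrite pmulr_rge0 ?dot_gt0// subr_ge0.
Qed.

Lemma dot_le x y : dot x y <= enorm x * enorm y.
Proof.
rewrite (le_trans (ler_norm _))// -ler_sqr ?nnegrE ?mulr_ge0 ?enorm_ge0//.
by rewrite real_normK ?num_real// exprMn !enorm_sq dot_sqr_le.
Qed.

Lemma dot_abs_le x y : `|dot x y| <= enorm x * enorm y.
Proof.
by rewrite ler_norml dot_le andbT lerNl -dotNl (le_trans (dot_le _ _))// enormN.
Qed.

Lemma enormD x y : enorm (x + y) <= enorm x + enorm y.
Proof.
rewrite enorm_le ?addr_ge0 ?enorm_ge0// !dotE (dotC y x) sqrrD !enorm_sq.
have := dot_le x y; lra.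
Qed.

Lemma enorm_coord x i : `|x i 0| <= enorm x.
Proof.
rewrite -(@sqrtr_sqr R) ler_wsqrtr// (bigD1 i)//= lerDl.
by apply: sumr_ge0 => j _; rewrite sqr_ge0.
Qed.

Lemma enorm_le_sum x : enorm x <= \sum_i `|x i 0|.
Proof.
rewrite enorm_le ?sumr_ge0// expr2 mulr_suml; apply: ler_sum => i _.
rewrite (le_trans (ler_norm _))// normrM ler_wpM2l//.
by rewrite (bigD1 i)//= lerDl sumr_ge0.
Qed.

Lemma enorm_normalize x : x != 0 -> enorm ((enorm x)^-1 *: x) = 1.
Proof.
move=> x0; rewrite enormZ ger0_norm ?invr_ge0 ?enorm_ge0// mulVf//.
by rewrite enorm_eq0.
Qed.

Lemma enorm1_dot x : enorm x = 1 -> dot x x = 1.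
Proof. by move=> x1; rewrite -enorm_sq x1 expr1n. Qed.

Lemma eballE (c : 'cV[R]_n) r x : eball c r x = (enorm (x - c) <= r) :> Prop.
Proof. by []. Qed.

Lemma eball0E r x : eball 0 r x = (enorm x <= r) :> Prop.
Proof. by rewrite eballE subr0. Qed.

End Dot.

Lemma dot_mulmxl (R : realType) m n (A : 'M[R]_(m, n)) x y :
  dot (A *m x) y = dot x (A^T *m y).
Proof.
rewrite /dot; under eq_bigr do rewrite mxE mulr_suml.
rewrite exchange_big /=; apply: eq_bigr => j _.
by rewrite mxE mulr_sumr; apply: eq_bigr => i _; rewrite !mxE; ring.
Qed.

Lemma mulmx_dot (R : realType) n m (x : 'cV[R]_n) (y : 'cV[R]_n) (v : 'cV[R]_m) :
  v *m x^T *m y = dot x y *: v.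
Proof.
rewrite -mulmxA [x^T *m y]mx11_scalar mul_mx_scalar mxE; congr (_ *: _).
by apply: eq_bigr => i _; rewrite mxE.
Qed.

Lemma mulmx_dotr (R : realType) n (x : 'cV[R]_n) (y : 'cV[R]_n) :
  (x^T *m y) 0 0 = dot x y.
Proof. by rewrite mxE; apply: eq_bigr => i _; rewrite mxE. Qed.

(** * Convexity and compactness in coordinates *)

Section Topology.
Context {R : realType}.

Lemma convex_setP (n : nat) (K : set 'cV[R]_n) :
  convex_set K <-> forall x y t, K x -> K y -> 0 <= t <= 1 ->
    K (t *: x + (1 - t) *: y).
Proof.
split=> [cK x y t Kx Ky t01|cK x y t].
  have := cK x y (Itv01 (andP t01).1 (andP t01).2).
  by rewrite !inE => /(_ Kx Ky).
by rewrite !inE => Kx Ky; apply: cK => //; rewrite ge0/= le1.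
Qed.

(** Neighbourhoods of a matrix are products of neighbourhoods of its entries. *)
Lemma mx_continuous (T : topologicalType) m n (f : T -> 'M[R]_(m, n)) :
  (forall i j, continuous (fun x => f x i j)) -> continuous f.
Proof.
move=> cf x A [P HP sPA].
suff : \forall y \near x, forall i j, P i j (f y i j).
  by apply: filterS => y Py; apply: sPA.
apply: filter_forall => i; apply: filter_forall => j.
by apply: (cf i j x); apply: HP.
Qed.

Lemma mx_entries_compact m n (M : R) :
  compact [set A : 'M[R]_(m, n) | forall i j, `|A i j| <= M].
Proof.
pose S := [set v : 'rV[R]_(m * n) | forall i, v ord0 i \in `[(- M), M]].
have cS : compact S.
  apply: (@rV_compact _ _ (fun=> `[(- M), M]%classic)) => _.
  exact: segment_compact.
have cv : continuous (vec_mx : 'rV[R]_(m * n) -> 'M[R]_(m, n)).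
  apply: mx_continuous => i j x; under eq_fun do rewrite mxE.
  exact: coord_continuous.
rewrite (_ : mkset _ = vec_mx @` S).
  apply: continuous_compact => //; exact: continuous_subspaceT.
apply/seteqP; split=> [A AM|_ [v vS <-] i j] /=.
  exists (mxvec A); last exact: mxvecK.
  move=> k; have [i j] := (mxvec_indexP k).
  by rewrite mxvecE /= in_itv /= -ler_norml.
rewrite mxE ler_norml; have := vS (mxvec_index i j).
by rewrite /= in_itv.
Qed.

Lemma mx_bounded_compact m n (M : R) (S : set 'M[R]_(m, n)) :
  closed S -> (forall A, S A -> forall i j, `|A i j| <= M) -> compact S.
Proof.
by move=> cS SM; exact: (subclosed_compact cS (@mx_entries_compact m n M)).
Qed.

Lemma enorm_bounded_compact n (M : R) (S : set 'cV[R]_n) :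
  closed S -> (forall x, S x -> enorm x <= M) -> compact S.
Proof.
move=> cS SM; apply: (@mx_bounded_compact _ _ M) => // x Sx i j.
by rewrite ord1 (le_trans (enorm_coord _ _))// SM.
Qed.

Lemma coord_cts m n i j : continuous (fun A : 'M[R]_(m, n) => A i j).
Proof. by move=> A; exact: coord_continuous. Qed.

Lemma mul_cts (T : topologicalType) (f g : T -> R) :
  continuous f -> continuous g -> continuous (fun x => f x * g x).
Proof. by move=> cf cg x; apply: cvgM; [exact: cf|exact: cg]. Qed.

Lemma fst_cts (T U : topologicalType) : continuous (@fst T U).
Proof. by move=> x; exact: cvg_fst. Qed.

Lemma snd_cts (T U : topologicalType) : continuous (@snd T U).
Proof. by move=> x; exact: cvg_snd. Qed.

Lemma cst_cts (T U : topologicalType) (c : U) : continuous (fun _ : T => c).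
Proof. exact: cst_continuous. Qed.

Lemma comp_cts (T U V : topologicalType) (g : U -> V) (f : T -> U) :
  continuous g -> continuous f -> continuous (fun x => g (f x)).
Proof. by move=> cg cf x; exact: (continuous_comp (cf x) (cg _)). Qed.

Lemma abs_cts (T : topologicalType) (f : T -> R) :
  continuous f -> continuous (fun x => `|f x|).
Proof. by move=> cf; apply: (comp_cts _ cf); exact: norm_continuous. Qed.

Lemma add_cts (T : topologicalType) (f g : T -> R) :
  continuous f -> continuous g -> continuous (fun x => f x + g x).
Proof. by move=> cf cg x; apply: cvgD; [exact: cf|exact: cg]. Qed.

Lemma opp_cts (T : topologicalType) (f : T -> R) :
  continuous f -> continuous (fun x => - f x).
Proof. by move=> cf x; apply: cvgN; exact: cf. Qed.

Lemma id_cts (T : topologicalType) : continuous (fun x : T => x).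
Proof. by move=> x; exact: cvg_id. Qed.

Lemma coord_comp_cts (T : topologicalType) m n (f : T -> 'M[R]_(m, n)) i j :
  continuous f -> continuous (fun x => f x i j).
Proof. by move=> cf x; exact: (continuous_comp (cf x) (@coord_cts _ _ _ _ _)). Qed.

Lemma mxD_cts (T : topologicalType) m n (f g : T -> 'M[R]_(m, n)) :
  continuous f -> continuous g -> continuous (fun x => f x + g x).
Proof.
move=> cf cg; apply: mx_continuous => i j; under eq_fun do rewrite mxE.
by apply: add_cts; exact: coord_comp_cts.
Qed.

Lemma mxZ_cts (T : topologicalType) m n (a : T -> R) (f : T -> 'M[R]_(m, n)) :
  continuous a -> continuous f -> continuous (fun x => a x *: f x).
Proof.
move=> cf cg; apply: mx_continuous => i j; under eq_fun do rewrite mxE.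
by apply: mul_cts => //; exact: coord_comp_cts.
Qed.

Lemma mxB_cts (T : topologicalType) m n (f g : T -> 'M[R]_(m, n)) :
  continuous f -> continuous g -> continuous (fun x => f x - g x).
Proof.
move=> cf cg; apply: mx_continuous => i j; under eq_fun do rewrite 2!mxE.
by apply: add_cts; [exact: coord_comp_cts|apply: opp_cts; exact: coord_comp_cts].
Qed.

Lemma sum_cts (T : topologicalType) (I : Type) (r : seq I) (P : pred I)
    (f : I -> T -> R) :
  (forall i, continuous (f i)) -> continuous (fun x => \sum_(i <- r | P i) f i x).
Proof.
move=> cf; elim: r => [|i r IH].
  by under eq_fun do rewrite big_nil; exact: cst_continuous.
under eq_fun do rewrite big_cons.
case: (P i) => // x; apply: cvgD; [exact: cf|exact: IH].
Qed.

Lemma prod_cts (T : topologicalType) (I : Type) (r : seq I) (P : pred I)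
    (f : I -> T -> R) :
  (forall i, continuous (f i)) -> continuous (fun x => \prod_(i <- r | P i) f i x).
Proof.
move=> cf; elim: r => [|i r IH].
  by under eq_fun do rewrite big_nil; exact: cst_continuous.
under eq_fun do rewrite big_cons.
case: (P i) => // x; apply: cvgM; [exact: cf|exact: IH].
Qed.

Lemma dot_cts (T : topologicalType) n (f g : T -> 'cV[R]_n) :
  continuous f -> continuous g -> continuous (fun x => dot (f x) (g x)).
Proof.
move=> cf cg; apply: sum_cts => i x.
by apply: cvgM; exact: coord_comp_cts.
Qed.

Lemma enorm_cts (T : topologicalType) n (f : T -> 'cV[R]_n) :
  continuous f -> continuous (fun x => enorm (f x)).
Proof.
move=> cf x.
have -> : (fun x => enorm (f x)) = Num.sqrt \o (fun x => dot (f x) (f x)).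
  by apply/funext => y; rewrite /= enormE.
apply: continuous_comp; first exact: dot_cts.
exact: sqrt_continuous.
Qed.

Lemma mulmx_cts (T : topologicalType) m n p (f : T -> 'M[R]_(m, n))
    (g : T -> 'M[R]_(n, p)) :
  continuous f -> continuous g -> continuous (fun x => f x *m g x).
Proof.
move=> cf cg; apply: mx_continuous => i j.
under eq_fun do rewrite mxE.
apply: sum_cts => k x.
by apply: cvgM; exact: coord_comp_cts.
Qed.

Lemma det_cts n : continuous (fun A : 'M[R]_n => \det A).
Proof.
apply: sum_cts => s; apply: mul_cts; first exact: cst_continuous.
by apply: prod_cts => i; exact: coord_cts.
Qed.

Lemma closed_cts_le (T : topologicalType) (f g : T -> R) :
  continuous f -> continuous g -> closed [set x | f x <= g x].
Proof.
move=> cf cg; rewrite (_ : mkset _ = (fun x => g x - f x) @^-1` [set y | 0 <= y]).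
  apply: closed_comp; last exact: closed_ge.
  by move=> x _; apply: cvgB; [exact: cg|exact: cf].
by apply/seteqP; split=> x /=; rewrite subr_ge0.
Qed.

Lemma closed_forall (I : Type) (U : topologicalType) (F : I -> set U) (D : set I) :
  (forall i, D i -> closed (F i)) -> closed [set x | forall i, D i -> F i x].
Proof. by move=> cF; apply: closed_bigI. Qed.

Lemma closed_cts (T U : topologicalType) (f : T -> U) (S : set U) :
  continuous f -> closed S -> closed (f @^-1` S).
Proof. by move=> cf cS; apply: closed_comp => // x _; exact: cf. Qed.

Lemma closed_setAnd (T : topologicalType) (P Q : T -> Prop) :
  closed [set x | P x] -> closed [set x | Q x] -> closed [set x | P x /\ Q x].
Proof. exact: closedI. Qed.

Lemma compact_argmin (T : topologicalType) (S : set T) (f : T -> R) :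
  S !=set0 -> compact S -> continuous f ->
  exists2 x, S x & forall y, S y -> f x <= f y.
Proof.
move=> S0 cS cf; have [|x] := compact_EVT_min S0 cS (f := f).
  exact: continuous_subspaceT.
by rewrite inE => Sx xm; exists x => // y Sy; apply: xm; rewrite inE.
Qed.

Lemma cV_compact_closed m n (S : set 'M[R]_(m, n)) : compact S -> closed S.
Proof. by apply: compact_closed; exact: norm_hausdorff. Qed.

Lemma compact_enorm_bound n (K : set 'cV[R]_n) :
  compact K -> exists2 M : R, 0 < M & forall x, K x -> enorm x <= M.
Proof.
move=> cK; have [K0|K0] := pselect (K !=set0); last first.
  by exists 1 => // x Kx; exfalso; apply: K0; exists x.
have [|x Kx xm] := compact_argmin (f := fun x => - enorm x) K0 cK.
  by apply: opp_cts; apply: enorm_cts; exact: id_cts.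
exists (enorm x + 1); first by rewrite ltr_wpDl ?enorm_ge0.
move=> y /xm; rewrite lerN2 => /le_trans; apply; lra.
Qed.

(** The topology of matrices is that of the sup norm, which is at most the
    Euclidean norm and at least a multiple of it: hence this lemma and the
    next. *)
Lemma interior_eball n (K : set 'cV[R]_n) c :
  interior K c -> exists2 r : R, 0 < r & eball c r `<=` K.
Proof.
move=> /nbhs_ballP[e /= e0 eK]; exists (e / 2); first by rewrite divr_gt0.
move=> x xc; apply: eK; split=> // i j; rewrite ord1.
have := enorm_coord (x - c) i; rewrite /= /ball_ /ball/= distrC !mxE.
move: xc; rewrite eballE; lra.
Qed.

Lemma eball_interior n (K : set 'cV[R]_n) c (r : R) :
  0 < r -> eball c r `<=` K -> interior K c.
Proof.
move=> r0 rK; apply/nbhs_ballP; exists (r / (n%:R + 1)) => /=.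
  by rewrite divr_gt0// ltr_wpDl.
have n1 : 0 < n%:R + 1 :> R by rewrite ltr_wpDl.
move=> x [_ xc]; apply: rK; rewrite eballE.
apply: le_trans (enorm_le_sum _) _.
apply: (@le_trans _ _ (\sum_(i < n) (r / (n%:R + 1)))).
  apply: ler_sum => i _; have := xc i 0; rewrite /ball/= !mxE distrC => /ltW//.
rewrite sumr_const card_ord -[X in X <= _]mulr_natr -mulrA ler_piMr ?(ltW r0)//.
by rewrite mulrC ler_pdivrMr// mul1r lerDl.
Qed.

End Topology.

(** * Volume of ellipsoids *)

Section Volume.
Context {R : realType}.
Notation mu := (@lebesgue_measure R).

(** The witness is the reflection in the hyperplane orthogonal to [a - b]. *)
Lemma householder n (a b : 'cV[R]_n) : enorm a = enorm b ->
  exists H : 'M[R]_n, [/\ H^T = H, H *m H = 1%:M & H *m a = b].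
Proof.
move=> ab; have [->|/[dup] zE] := eqVneq a b.
  by exists 1%:M; rewrite trmx1 mulmx1 mul1mx.
rewrite -subr_eq0; set z := a - b => z0.
have zz : dot z z != 0 by rewrite dot_eq0.
pose H : 'M[R]_n := 1%:M - (2 / dot z z) *: (z *m z^T).
have HE x : H *m x = x - (2 * dot z x / dot z z) *: z.
  rewrite /H mulmxBl mul1mx -scalemxAl mulmx_dot scalerA; congr (_ - _ *: _).
  by rewrite mulrAC.
exists H; split.
- by rewrite /H linearB linearZ /= trmx1 trmx_mul trmxK.
- rewrite /H; set P := _ *: (z *m z^T).
  have PP : P *m P = P + P.
    rewrite /P -scalemxAl -scalemxAr !mulmxA.
    rewrite mulmx_dot -scalemxAl !scalerA mulfVK// -scalerDl.
    by congr (_ *: _); ring.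
  by rewrite mulmxBl mul1mx mulmxBr mulmx1 PP opprB addrK subrK.
- rewrite HE; have -> : 2 * dot z a = dot z z.
    have : dot a a = dot b b by rewrite -!enorm_sq ab.
    by rewrite /z !dotE (dotC b a) => ->; ring.
  by rewrite divff// scale1r /z opprB addrC subrK.
Qed.


Lemma ellipsoid_orth n (c : 'cV[R]_n) (A H : 'M[R]_n) :
  H^T = H -> H *m H = 1%:M -> ellipsoid c (A *m H) = ellipsoid c A.
Proof.
move=> HT HH.
have Hn x : eball 0 1 x -> eball 0 1 (H *m x).
  by rewrite !eball0E !enormE dot_mulmxl HT mulmxA HH mul1mx.
apply/seteqP; split=> _ [x xB <-]; exists (H *m x); rewrite ?mulmxA//;
  try exact: Hn.
by rewrite -(mulmxA A) HH mulmx1.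
Qed.

Lemma orth_det (n : nat) (H : 'M[R]_n) : H *m H = 1%:M -> `|\det H| = 1.
Proof.
move=> HH; apply/eqP; rewrite -(@eqrXn2 _ 2)// expr1n -normrX.
by rewrite expr2 -det_mulmx HH det1 normr1.
Qed.

(** A reflection sending the first row of [A] to a multiple of the first basis
    vector changes neither the ellipsoid nor [|det A|]; afterwards the sections
    by a fixed first coordinate are ellipsoids with matrix [A']. *)
Lemma ellipsoid_lower m (c : 'cV[R]_(1 + m)) (A : 'M[R]_(1 + m)) :
  A \in unitmx -> exists l (v : 'cV[R]_m) (A' : 'M[R]_m),
    [/\ 0 < l, A' \in unitmx, `|\det A| = l * `|\det A'| &
        ellipsoid c A = ellipsoid c (block_mx l%:M 0 v A')].
Proof.
move=> uA; pose a := (row 0 A)^T; pose e : 'cV[R]_(1 + m) := delta_mx 0 0.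
have e1 : enorm e = 1.
  rewrite enormE /dot (bigD1 0)//= big1 ?addr0 ?mxE ?eqxx ?mulr1 ?sqrtr1//.
  by move=> i i0; rewrite mxE (negbTE i0) mul0r.
have [|H [HT HH Ha]] := householder (a := a) (b := enorm a *: e).
  by rewrite enormZ e1 mulr1 ger0_norm ?enorm_ge0.
have rowAH : row 0 (A *m H) = enorm a *: e^T.
  by rewrite row_mul -[row 0 A]trmxK -/a -[H]HT -trmx_mul Ha linearZ.
have [B BE0] : exists B, B = A *m H by exists (A *m H).
rewrite -BE0 in rowAH.
have B0 (j : 'I_(1 + m)) : B 0 j = enorm a * (j == 0)%:R.
  by have /matrixP/(_ 0 j) := rowAH; rewrite 3!mxE => ->; rewrite !mxE andbT.
have ulB : ulsubmx B = (enorm a)%:M.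
  apply/matrixP => i j; rewrite !ord1 /ulsubmx /usubmx /lsubmx !mxE.
  have -> : lshift m (0 : 'I_1) = 0 by apply/val_inj.
  by rewrite B0 eqxx mulr1.
have urB : ursubmx B = 0.
  apply/matrixP => i j; rewrite !ord1 /ursubmx /usubmx /rsubmx !mxE.
  have -> : lshift m (0 : 'I_1) = 0 by apply/val_inj.
  by rewrite B0 mulr0.
have BE : B = block_mx (enorm a)%:M 0 (dlsubmx B) (drsubmx B).
  by rewrite -ulB -urB submxK.
have dB : `|\det A| = enorm a * `|\det (drsubmx B)|.
  have -> : `|\det A| = `|\det B| by rewrite BE0 det_mulmx normrM (orth_det HH) mulr1.
  by rewrite BE det_lblock block_mxKdr det_scalar1 normrM ger0_norm ?enorm_ge0.
have : `|\det A| != 0 by rewrite normr_eq0 -unitfE -unitmxE.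
rewrite dB mulf_eq0 negb_or normr_eq0 => /andP[a0 d0].
exists (enorm a), (dlsubmx B), (drsubmx B); split=> //.
- by rewrite lt_def a0 enorm_ge0.
- by rewrite unitmxE unitfE.
- by rewrite -BE BE0 ellipsoid_orth.
Qed.

(** For [|u| < 1] this is an ellipsoid with matrix [sqrt (1 - u ^ 2) A], for
    [|u| = 1] a point and for [|u| > 1] empty. *)
Lemma ellipsoid_section m (c : 'cV[R]_(1 + m)) l (v : 'cV[R]_m) (A : 'M[R]_m) t :
  0 < l -> let u := (t - c 0 0) / l in
  [set y | ellipsoid c (block_mx l%:M 0 v A) (col_mx t%:M y)] =
  [set dsubmx c + u *: v + A *m x | x in [set x | dot x x <= 1 - u ^+ 2]].
Proof.
move=> l0 u; have cE : c = col_mx (c 0 0)%:M (dsubmx c).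
  rewrite -[LHS]vsubmxK; congr col_mx; apply/matrixP => i j.
  by rewrite !ord1 !mxE eqxx mulr1n; congr (c _ _); apply/val_inj.
have dotcol s (x : 'cV[R]_m) : dot (col_mx s%:M x : 'cV[R]_(1 + m)) (col_mx s%:M x)
     = s ^+ 2 + dot x x.
  rewrite {1}/dot big_split_ord big_ord1 /=; congr (_ + _).
    by rewrite !col_mxEu !mxE eqxx expr2.
  by apply: eq_bigr => i _; rewrite !col_mxEd.
have img s x : c + block_mx l%:M 0 v A *m (col_mx s%:M x : 'cV[R]_(1 + m)) =
    col_mx (c 0 0 + l * s)%:M (dsubmx c + s *: v + A *m x).
  rewrite {1}cE mul_block_col mul0mx addr0 add_col_mx -scalar_mxM -raddfD /=.
  by rewrite mul_mx_scalar addrA.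
apply/seteqP; split=> y /=.
  move=> [x]; rewrite eball0E enorm_le// expr1n => x1 xE.
  have xs : x = col_mx (x 0 0)%:M (dsubmx x).
    rewrite -[LHS]vsubmxK; congr col_mx; apply/matrixP => i j.
    by rewrite !ord1 !mxE eqxx mulr1n; congr (x _ _); apply/val_inj.
  move: xE; rewrite xs img => /eq_col_mx[/matrixP/(_ 0 0)].
  rewrite !mxE eqxx !mulr1n => tE <-.
  have uE : u = x 0 0 by rewrite /u -tE addrAC subrr add0r mulrAC divff ?mul1r ?gt_eqF.
  exists (dsubmx x); last by rewrite uE.
  by move: x1; rewrite xs dotcol col_mxKd uE => /=; lra.
move=> [x xu <-]; exists (col_mx u%:M x).
  by rewrite eball0E enorm_le// expr1n dotcol; move: xu; rewrite /=; lra.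
by rewrite img; congr col_mx; congr scalar_mx; rewrite /u mulrC divfK ?gt_eqF// addrC subrK.
Qed.

End Volume.

Section VolumeEllipsoid.
Context {R : realType}.
Notation mu := (@lebesgue_measure R).

Lemma integral_affine (G : R -> R) (c l : R) : 0 < l -> continuous G ->
  (forall u, 0 <= G u) ->
  (\int[mu]_t (G ((t - c) / l))%:E = l%:E * \int[mu]_u (G u)%:E)%E.
Proof.
move=> l0 cG G0; pose F (t : R) := (t - c) / l.
have l'0 : 0 < l^-1 by rewrite invr_gt0.
have dF (t : R) : is_derive t 1 F l^-1.
  by rewrite /F; apply: is_derive_eq; rewrite scaler0 add0r subr0 /GRing.scale/= mulr1.
have dFE : derive1 F = cst l^-1.
  by apply/funext => t; rewrite derive1E; apply: derive_val.
have lG0 u : 0 <= l * G u by rewrite mulr_ge0// ltW.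
have clG : continuous (fun u => l * G u).
  by apply: mul_cts => //; exact: cst_continuous.
rewrite -ge0_integralZl_EFin//; last 3 first.
- by move=> u _; rewrite lee_fin.
- by apply/measurable_EFinP; exact: continuous_measurable_fun.
- exact: ltW.
rewrite (@increasing_ge0_integration_by_substitutionT R F (fun u => l * G u)) ?dFE //=.
- apply: eq_integral => t _; congr EFin.
  by rewrite /= mulrfctE /= mulrAC divff ?mul1r// gt_eqF.
- by move=> x y xy; rewrite ltr_pM2r// ltrD2r.
- exact: cst_continuous.
- exact: is_cvg_cst.
- exact: is_cvg_cst.
- apply/cvgrNyPle => M; near=> x.
  rewrite /F ler_pdivrMr// lerBlDr.
  by near: x; apply: nbhs_ninfty_le; exact: num_real.
- apply/cvgryPge => M; near=> x.
  rewrite /F ler_pdivlMr// lerBrDr.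
  by near: x; apply: nbhs_pinfty_ge; exact: num_real.
Unshelve. all: by end_near. Qed.

Lemma volumeS n (S : set 'cV[R]_(1 + n)) :
  (volume S = \int[mu]_t volume [set y : 'cV[R]_n | S (col_mx t%:M y)])%E.
Proof. by []. Qed.

Lemma volume_set0 n : volume (set0 : set 'cV[R]_n) = 0%E.
Proof.
elim: n => [|n IH] /=; first by rewrite indic0.
by rewrite integral0_eq// => t _; rewrite -[RHS]IH; congr volume; apply/seteqP; split.
Qed.

Lemma col_mx_scalarP n (p : 'cV[R]_(1 + n)) t y :
  col_mx t%:M y = p <-> t = p 0 0 /\ y = dsubmx p.
Proof.
have pE : p = col_mx (p 0 0)%:M (dsubmx p).
  rewrite -[LHS]vsubmxK; congr col_mx; apply/matrixP => i j.
  by rewrite !ord1 !mxE eqxx mulr1n; congr (p _ _); apply/val_inj.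
split=> [<-|[-> ->]]; last by rewrite -pE.
rewrite col_mxKd; split=> //; rewrite mxE.
by case: splitP => // j /= jE; rewrite !ord1 mxE eqxx mulr1n.
Qed.

Lemma volume_point0 (S : set 'cV[R]_0) : volume S = (\1_S 0 : R)%:E.
Proof. by []. Qed.

Lemma cV0_eq (x y : 'cV[R]_0) : x = y.
Proof. by apply/matrixP => -[]. Qed.

Lemma volume1_itv (S : set 'cV[R]_1) (a b : R) : a <= b ->
  (forall t, S (col_mx t%:M (0 : 'cV[R]_0)) <-> a <= t <= b) ->
  volume S = (b - a)%:E.
Proof.
move=> ab HS; rewrite /volume /=.
transitivity (\int[mu]_t (\1_(`[a, b]%classic) t)%:E)%E.
  apply: eq_integral => t _; congr EFin; rewrite !indicE; congr ((nat_of_bool _)%:R).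
  by apply/idP/idP; rewrite !inE /= in_itv /= -HS.
rewrite integral_indic// setIT [LHS](@lebesgue_measure_itv R `[a, b])/= lte_fin.
case: ltP => // ba; congr EFin; apply/eqP; rewrite eq_sym subr_eq0.
by rewrite eq_le ba ab.
Qed.

Lemma volume_set1 n (p : 'cV[R]_(1 + n)) : volume [set p] = 0%E.
Proof.
elim: n p => [|n IH] p.
  rewrite (@volume1_itv _ (p 0 0) (p 0 0)) ?subrr// => t; split=> /=.
    by move=> /(@col_mx_scalarP 0)[-> _]; rewrite lexx.
  move=> pt; apply: (proj2 (@col_mx_scalarP 0 p t 0)); split; last exact: cV0_eq.
  by apply/eqP; rewrite eq_le andbC.
rewrite volumeS integral0_eq// => t _.
have [tp|tp] := eqVneq t (p 0 0).
  rewrite -[RHS](IH (dsubmx (p : 'cV[R]_(1 + n.+1)))).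
  apply: (congr1 (@volume R n.+1)); apply/seteqP; split => y /=.
    by move=> /(@col_mx_scalarP n.+1)[].
  by move=> ->; apply/(@col_mx_scalarP n.+1).
rewrite -[RHS](volume_set0 n.+1).
apply: (congr1 (@volume R n.+1)); apply/seteqP; split => y //=.
by move=> /(@col_mx_scalarP n.+1)[/eqP]; rewrite (negbTE tp).
Qed.

(** [k] is the volume of the unit ball. *)
Definition ellipsoid_volume n (k : R) := 0 < k /\
  forall (c : 'cV[R]_n) A, A \in unitmx ->
    volume (ellipsoid c A) = (k * `|\det A|)%:E.

Lemma ellipsoid_volume0 : ellipsoid_volume 0 1.
Proof.
split=> // c A uA; rewrite det_mx00 normr1 mulr1 volume_point0 indicE mem_set//.
by exists 0; [rewrite eball0E enorm0|exact: cV0_eq].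
Qed.

Lemma ellipsoid_volume1 : ellipsoid_volume 1 2.
Proof.
split=> // c A uA.
have [l [v [A' [l0 uA' -> ->]]]] := ellipsoid_lower (m := 0) c uA.
rewrite det_mx00 normr1 mulr1.
rewrite (@volume1_itv _ (c 0 0 - l) (c 0 0 + l)); [by congr EFin; ring|lra|].
move=> t; have /seteqP[S1 S2] := ellipsoid_section (m := 0) c v A' t l0.
have tE : (1 - ((t - c 0 0) / l) ^+ 2 >= 0) = (c 0 0 - l <= t <= c 0 0 + l).
  rewrite subr_ge0 -[_ ^+ 2]real_normK ?num_real// expr_le1// ler_norml.
  by rewrite ler_pdivlMr// ler_pdivrMr//; apply/andP/andP => -[]; lra.
rewrite -tE; split=> [/S1 /= [x + _]|Ht].
  by rewrite /dot big_ord0.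
by apply: S2; exists 0; [rewrite /= dot0l|exact: cV0_eq].
Qed.


(* volume of the section of the unit ball of dimension [n + 2] at height [u],
   divided by the volume of the unit ball of dimension [n + 1] *)
Let g n (u : R) : R := Num.sqrt (1 - u ^+ 2) ^+ n.+1.

Lemma g_cts n : continuous (g n).
Proof.
have c1 : continuous (fun u : R => 1 - u ^+ 2).
  apply: add_cts; first exact: cst_continuous.
  apply: opp_cts; exact: exprn_continuous.
move=> u; rewrite (_ : g n = (fun x => x ^+ n.+1) \o (Num.sqrt \o (fun u => 1 - u ^+ 2)))//.
apply: continuous_comp; last exact: exprn_continuous.
apply: continuous_comp; [exact: c1|exact: sqrt_continuous].
Qed.

Lemma g_ge0 n u : 0 <= g n u.
Proof. by rewrite exprn_ge0// sqrtr_ge0. Qed.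

Lemma g_integral n : exists2 j, 0 < j & (\int[mu]_u (g n u)%:E = j%:E)%E.
Proof.
have mg : measurable_fun setT (fun u => (g n u)%:E).
  by apply/measurable_EFinP; apply: continuous_measurable_fun; exact: g_cts.
have upper : (\int[mu]_u (g n u)%:E <= 2%:E)%E.
  apply: (@le_trans _ _ (\int[mu]_u (\1_(`[(-1)%R, 1%R]%classic) u)%:E)%E).
    apply: ge0_le_integral => //.
    - by move=> u _; rewrite lee_fin g_ge0.
    - by apply/measurable_EFinP; exact: measurable_indic.
    - move=> u _; rewrite lee_fin indicE; case: (boolP (_ \in _)).
        by move=> _; rewrite exprn_ile1 ?sqrtr_ge0// -[X in _ <= X](sqrtr1) ler_sqrt//
          gerBl sqr_ge0.
      rewrite notin_setE /= in_itv /= => /negP; rewrite -ler_norml -ltNge => u1.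
      rewrite /g ler0_sqrtr ?expr0n// subr_le0 -[_ ^+ 2]real_normK ?num_real//.
      by rewrite exprn_ege1// ltW.
  rewrite integral_indic// setIT [X in (X <= _)%E](@lebesgue_measure_itv R `[-1, 1])/=.
  by rewrite lte_fin ifT ?lee_fin; lra.
have lower : ((Num.sqrt (3 / 4) ^+ n.+1)%:E <= \int[mu]_u (g n u)%:E)%E.
  apply: (@le_trans _ _ (\int[mu]_(u in `[(- (1 / 2))%R, (1 / 2)%R]) (Num.sqrt (3 / 4) ^+ n.+1)%:E)%E).
    rewrite integral_cst// [X in (_ * X)%E](@lebesgue_measure_itv R `[-(1/2), (1/2)])/=.
    rewrite lte_fin ifT; last lra.
    by rewrite -EFinD -EFinM lee_fin ler_peMr ?exprn_ge0 ?sqrtr_ge0//; lra.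
  apply: (@le_trans _ _ (\int[mu]_(u in `[(- (1 / 2))%R, (1 / 2)%R]) (g n u)%:E)%E).
    apply: ge0_le_integral => //.
    - exact: measurable_funTS.
    - move=> u /=; rewrite in_itv/= lee_fin => u1.
      rewrite lerXn2r ?nnegrE ?sqrtr_ge0// ler_wsqrtr//; nra.
  apply: ge0_subset_integral => //.
  by move=> u _; rewrite lee_fin g_ge0.
have : ((\int[mu]_u (g n u)%:E) \is a fin_num)%E.
  rewrite ge0_fin_numE; first exact: le_lt_trans upper (ltry _).
  by apply: integral_ge0 => u _; rewrite lee_fin g_ge0.
move=> fj; exists (fine (\int[mu]_u (g n u)%:E)%E); last by rewrite fineK.
rewrite -lte_fin fineK//; apply: lt_le_trans lower.
by rewrite lte_fin exprn_gt0// sqrtr_gt0; lra.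
Qed.

(** Sections have volume [k |det A'| g ((t - c0) / l)], and substituting
    [u = (t - c0) / l] in the integral over [t] brings out the missing factor
    [l] of [|det A|].  The formula for the sections also holds at [|u| = 1],
    because points have volume zero in positive dimension; this is why
    dimension one is treated apart. *)
Lemma ellipsoid_volumeS n k : ellipsoid_volume n.+1 k ->
  exists k', ellipsoid_volume n.+2 k'.
Proof.
move=> [k0 kV]; have [j j0 jE] := g_integral n.
exists (k * j); split; first exact: mulr_gt0.
move=> c A uA.
have [l [v [A' [l0 uA' -> ->]]]] := ellipsoid_lower (m := n.+1) c uA.
rewrite volumeS.
transitivity (\int[mu]_t ((k * `|\det A'|) * g n ((t - c 0 0) / l))%:E)%E.
  apply: eq_integral => t _; rewrite (ellipsoid_section c v A' t l0).
  set u := _ / l; set D : 'cV[R]_n.+1 := dsubmx _ + _; have [u1|u1|u1] := ltgtP (1 - u ^+ 2) 0.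
  - rewrite /g ler0_sqrtr ?(ltW u1)// expr0n mulr0.
    rewrite -[RHS](volume_set0 n.+1); congr volume; apply/seteqP; split=> //.
    by move=> y [x /= xu]; have := le_lt_trans (le_trans (dot_ge0 x) xu) u1; rewrite ltxx.
  - pose r := Num.sqrt (1 - u ^+ 2).
    have r0 : 0 < r by rewrite sqrtr_gt0.
    have -> : [set D + A' *m x | x in [set x | dot x x <= 1 - u ^+ 2]]
        = ellipsoid D (r *: A').
      apply/seteqP; split=> _ [x /= xu <-].
        exists (r^-1 *: x).
          rewrite eball0E enorm_le// expr1n !dotE mulrA -expr2 exprVn.
          by rewrite mulrC ler_pdivrMr ?exprn_gt0// mul1r sqr_sqrtr//; exact: ltW.
        by rewrite -scalemxAr -scalemxAl scalerA mulVf ?scale1r// gt_eqF.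
      exists (r *: x); last by rewrite -scalemxAr -scalemxAl.
      move: xu; rewrite eball0E enorm_le//= expr1n => xu.
      by rewrite !dotE mulrA -expr2 sqr_sqrtr ?ler_piMr// ltW.
    rewrite kV; last first.
      by rewrite unitmxE detZ unitrM -[\det A' \is a _]unitmxE uA' andbT unitrX// unitfE gt_eqF.
    congr EFin; rewrite detZ normrM ger0_norm ?exprn_ge0 ?ltW// /g -/r; ring.
  - rewrite /g u1 sqrtr0 expr0n mulr0.
    rewrite -[RHS](volume_set1 (D : 'cV[R]_(1 + n))).
    apply: (congr1 (@volume R n.+1)); apply/seteqP; split=> y /=.
      move=> [x x0 <-]; have /eqP : dot x x = 0.
        by apply/eqP; rewrite eq_le x0 dot_ge0.
      by rewrite dot_eq0 => /eqP ->; rewrite mulmx0 addr0.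
    by move=> ->; exists 0; rewrite /= ?dot0l// mulmx0 addr0.
rewrite (@integral_affine (fun u => (k * `|\det A'|) * g n u))//.
- under eq_integral do rewrite EFinM.
  rewrite ge0_integralZl_EFin//.
  + by rewrite jE -!EFinM; congr EFin; ring.
  + by move=> u _; rewrite lee_fin g_ge0.
  + by apply/measurable_EFinP; apply: continuous_measurable_fun; exact: g_cts.
  + by rewrite mulr_ge0// ltW.
- by apply: mul_cts; [exact: cst_continuous|exact: g_cts].
- by move=> u; rewrite !mulr_ge0 ?g_ge0// ltW.
Qed.

Lemma volume_ellipsoidE n : exists k, ellipsoid_volume n k.
Proof.
case: n => [|n]; first by exists 1; exact: ellipsoid_volume0.
elim: n => [|n [k kV]]; first by exists 2; exact: ellipsoid_volume1.
exact: ellipsoid_volumeS kV.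
Qed.

(** Maximality of volume among ellipsoids can thus be replaced by maximality of
    the determinant. *)
Lemma volume_ellipsoid_le n (c c' : 'cV[R]_n) A A' :
  A \in unitmx -> A' \in unitmx ->
  (volume (ellipsoid c A) <= volume (ellipsoid c' A'))%E =
  (`|\det A| <= `|\det A'|).
Proof.
move=> uA uA'; have [k [k0 kV]] := volume_ellipsoidE n.
by rewrite !kV// lee_fin ler_pM2l.
Qed.

End VolumeEllipsoid.

(** * Separation and rank-one determinants *)

Section Separation.
Context {R : realType}.

Lemma le0_of_le_small (a b : R) : (forall t, 0 < t <= 1 -> a <= t * b) -> a <= 0.
Proof.
move=> H; rewrite leNgt; apply/negP => a0.
have ab : a <= b by have := H 1; rewrite mul1r; apply; rewrite ltr01 lexx.
have b0 : 0 < b by apply: lt_le_trans ab.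
have := H (a / (2 * b)); have -> : a / (2 * b) * b = a / 2 by field; lra.
have : 0 < a / (2 * b) <= 1.
  by rewrite divr_gt0 ?mulr_gt0//= ler_pdivrMr ?mulr_gt0//; lra.
move=> -> /(_ isT); lra.
Qed.

(** The direction from the point [z] of [K] nearest to [x] separates: moving
    from [z] towards any [y] in [K] cannot decrease the distance to [x]. *)
Lemma separation n (K : set 'cV[R]_n) x :
  compact K -> convex_set K -> K !=set0 -> ~ K x ->
  exists2 g, enorm g = 1 & exists2 z, K z &
    forall y, K y -> dot g y <= dot g z < dot g x.
Proof.
move=> cK /convex_setP vK K0 Kx.
have [|z Kz zmin] := compact_argmin (f := fun z : 'cV[R]_n => enorm (z - x)) K0 cK.
  by apply: enorm_cts; apply: mxB_cts; [exact: id_cts|exact: cst_cts].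
pose v := x - z.
have v0 : v != 0 by rewrite subr_eq0; apply/eqP => xz; apply: Kx; rewrite xz.
have vle y : K y -> dot v (y - z) <= 0.
  move=> Ky; apply: (@le0_of_le_small _ (dot (y - z) (y - z) / 2)) => t t01.
  have := zmin _ (vK y z t Ky Kz _); rewrite (ltW (andP t01).1) (andP t01).2.
  move=> /(_ isT); rewrite enorm_le ?enorm_ge0// enorm_sq.
  have -> : t *: y + (1 - t) *: z - x = t *: (y - z) - v.
    by rewrite scalerBr scalerBl scale1r /v opprB; apply/matrixP => i j; rewrite !mxE; ring.
  have -> : dot (t *: (y - z) - v) (t *: (y - z) - v) =
     t * (t * dot (y - z) (y - z) - 2 * dot v (y - z)) + dot v v.
    by move: (v) (y - z) => v1 d; rewrite !dotE (dotC d v1); ring.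
  have -> : z - x = - v by rewrite /v opprB.
  rewrite dotNl dotNr opprK lerDr pmulr_rge0 ?(andP t01).1//; lra.
exists ((enorm v)^-1 *: v); first exact: enorm_normalize.
exists z => // y Ky; rewrite !dotZl ler_pM2l ?ltr_pM2l ?invr_gt0 ?enorm_gt0//.
apply/andP; split; first by have := vle y Ky; rewrite dotDr dotNr subr_le0.
by rewrite -subr_gt0 -dotNr -dotDr dot_gt0.
Qed.

(** The matrix determinant lemma: both sides are the determinant of the block
    matrix with diagonal blocks [1], [1] and off-diagonal blocks [- w^T], [z]. *)
Lemma det_rank1 n (z w : 'cV[R]_n) : \det (1%:M + z *m w^T) = 1 + dot w z.
Proof.
have dd : block_mx 1%:M 0 z 1%:M *m block_mx 1%:M (- w^T) 0 (1%:M + z *m w^T) =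
   block_mx (1%:M + w^T *m z) (- w^T) 0 1%:M *m block_mx 1%:M 0 z (1%:M : 'M[R]_n).
  rewrite !mulmx_block !mulmx1 !mul1mx !mul0mx !mulmx0 !addr0 !add0r.
  by rewrite mulmxN mulNmx addrK addrCA addNr addr0.
have := congr1 (@determinant _ _) dd.
rewrite !det_mulmx !det_lblock !det_ublock !det1 !mul1r !mulr1 => ->.
by rewrite det_mx11 mxE mxE eqxx mulmx_dotr.
Qed.

Lemma det_scalar_rank1 n (a : R) (z w : 'cV[R]_n.+1) : a != 0 ->
  \det (a%:M + z *m w^T) = a ^+ n * (a + dot w z).
Proof.
move=> a0; have -> : a%:M + z *m w^T = a *: (1%:M + (a^-1 *: z) *m w^T).
  by rewrite scalerDr scalemx1 -scalemxAl scalerA divff// scale1r.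
by rewrite detZ det_rank1 dotZr exprS; field.
Qed.

Lemma bernoulli n (y : R) : -1 <= y -> 1 + n%:R * y <= (1 + y) ^+ n.
Proof.
move=> y1; elim: n => [|n IH]; first by rewrite mul0r addr0 expr0.
rewrite exprS; apply: le_trans (ler_wpM2l _ IH); last lra.
have : 0 <= n%:R * y ^+ 2 by rewrite mulr_ge0// sqr_ge0.
rewrite -natr1; nra.
Qed.

End Separation.

(** * Ellipsoids of maximal volume *)

Section John.
Context {R : realType}.

Lemma delta_eball n (j : 'I_n) :
  eball 0 1 (delta_mx j 0 : 'cV[R]_n).
Proof.
rewrite eball0E enorm_le// expr1n /dot (bigD1 j)//= big1 ?addr0.
  by rewrite !mxE !eqxx mulr1.
by move=> i ij; rewrite mxE (negbTE ij) mul0r.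
Qed.

Lemma closed_ellipsoid_in n (K : set 'cV[R]_n) (T : topologicalType)
    (c : T -> 'cV[R]_n) (A : T -> 'M[R]_n) :
  closed K -> continuous c -> continuous A ->
  closed [set X | ellipsoid (c X) (A X) `<=` K].
Proof.
move=> cK cc cA.
rewrite (_ : mkset _ = [set X | forall x, eball 0 1 x -> K (c X + A X *m x)]).
  apply: (@closed_forall _ T (fun x X => K (c X + A X *m x))) => x _.
  apply: (closed_cts _ cK); apply: mxD_cts => //.
  by apply: mulmx_cts => //; exact: cst_cts.
by apply/seteqP; split=> X /= H; [move=> x xB; apply: H; exists x|
  move=> _ [x xB <-]; exact: H].
Qed.

Lemma ellipsoid_center_in n (K : set 'cV[R]_n) c A :
  ellipsoid c A `<=` K -> K c.
Proof.
by apply; exists 0; rewrite ?mulmx0 ?addr0// eball0E enorm0.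
Qed.

Lemma ellipsoid_entries n (K : set 'cV[R]_n) c A M :
  ellipsoid c A `<=` K -> (forall x, K x -> enorm x <= M) ->
  forall i j, `|A i j| <= 2 * M.
Proof.
move=> AK KM i j.
pose e : 'cV[R]_n := delta_mx j 0.
have Kj : K (c + A *m e) by apply: AK; exists e => //; exact: delta_eball.
have := KM _ Kj; have := KM _ (ellipsoid_center_in AK) => cM jM.
have -> : A i j = (A *m e) i 0.
  rewrite mxE (bigD1 j)//= big1 ?addr0; first by rewrite mxE !eqxx mulr1.
  by move=> k kj; rewrite mxE (negbTE kj) mulr0.
apply: le_trans (enorm_coord _ _) _.
have -> : A *m e = (c + A *m e) - c by rewrite addrAC subrr add0r.
by apply: le_trans (enormD _ _) _; rewrite enormN; lra.
Qed.

(** The pairs (centre, matrix) of possibly degenerate ellipsoids inside [K] form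
    a compact set; a ball inside [K] shows that degenerate ones are not optimal. *)
Lemma max_det_ellipsoid n (K : set 'cV[R]_n) : convex_body K ->
  exists c A, [/\ A \in unitmx, ellipsoid c A `<=` K &
    forall c' A', ellipsoid c' A' `<=` K -> `|\det A'| <= `|\det A|].
Proof.
move=> [cK vK [c0 /interior_eball[r r0 rK]]].
have [M M0 KM] := compact_enorm_bound cK.
pose S : set ('cV[R]_n * 'M[R]_n)%type := [set X | ellipsoid X.1 X.2 `<=` K].
have cS : compact S.
  apply: (@subclosed_compact _ _ ([set x : 'cV[R]_n | forall i j, `|x i j| <= M] `*`
     [set A : 'M[R]_n | forall i j, `|A i j| <= 2 * M])).
  - apply: closed_ellipsoid_in; [exact: cV_compact_closed|exact: fst_cts|exact: snd_cts].
  - by apply: compact_setX; exact: mx_entries_compact.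
  - move=> [c A] /= SA; split=> /= i j; last exact: (ellipsoid_entries SA KM).
    by rewrite ord1 (le_trans (enorm_coord _ _))// KM//; exact: ellipsoid_center_in SA.
have S0 : S (c0, r%:M).
  move=> _ [x + <-]; rewrite eball0E => x1; apply: rK.
  rewrite eballE addrAC subrr add0r mul_scalar_mx enormZ gtr0_norm//.
  by rewrite ler_piMr// ltW.
have [|[c A] SA Amax] := compact_argmin (f :=
  fun X : 'cV[R]_n * 'M[R]_n => - `|\det X.2|) (ex_intro _ _ S0) cS.
  by apply: opp_cts; apply: abs_cts; apply: (comp_cts (@det_cts R n)); exact: snd_cts.
exists c, A; split=> //.
- have := Amax _ S0; rewrite /= lerN2 det_scalar => dA.
  rewrite unitmxE unitfE -normr_eq0 gt_eqF//; apply: lt_le_trans dA.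
  by rewrite normr_gt0 expf_neq0// gt_eqF.
- by move=> c' A' AK'; have := Amax (c', A') AK'; rewrite /= lerN2.
Qed.

(** For [K] containing the unit ball these are the points where the boundary of
    [K] touches the unit sphere, the contact points of John's theorem. *)
Definition contact n (K : set 'cV[R]_n) : set 'cV[R]_n :=
  [set u | enorm u = 1 /\ forall z, K z -> dot z u <= 1].

(** Maximality of the unit ball is expressed through determinants; being the John
    ellipsoid in the sense of volume amounts to the same. *)
Definition john_position n (K : set 'cV[R]_n) :=
  [/\ compact K, convex_set K, eball 0 1 `<=` K &
    forall c A, A \in unitmx -> ellipsoid c A `<=` K -> `|\det A| <= 1].

(** Compactness makes an alternative quantitative: [phi] separates the directions
    where [Q > phi] from those where the support function of [K] exceeds
    [1 + phi]. *)
Lemma contact_gap n (K : set 'cV[R]_n) (Q : 'cV[R]_n -> R) :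
  continuous Q -> (forall u, contact K u -> 0 < Q u) ->
  exists2 phi, 0 < phi &
    forall u, enorm u = 1 -> (forall y, K y -> dot y u <= 1 + phi) -> phi < Q u.
Proof.
move=> cQ QU.
pose S : set ('cV[R]_n * R)%type := [set X | (forall y, K y -> dot y X.1 <= 1 + X.2)
  /\ Q X.1 <= X.2 /\ enorm X.1 <= 1 /\ 1 <= enorm X.1 /\ 0 <= X.2 /\ X.2 <= 1].
have c1 : continuous (fun X : 'cV[R]_n * R => X.1) by exact: fst_cts.
have c2 : continuous (fun X : 'cV[R]_n * R => X.2) by exact: snd_cts.
have cS : compact S.
  pose B : set ('cV[R]_n * R)%type :=
    [set x : 'cV[R]_n | forall i j, `|x i j| <= 1] `*` `[0, 1]%classic.
  have cB : compact B by apply: compact_setX; [exact: mx_entries_compact|exact: segment_compact].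
  apply: (subclosed_compact _ cB).
  - do ?apply: closed_setAnd; try (apply: closed_cts_le; first [exact: cst_cts
      | exact: enorm_cts | exact: c2 | exact: (comp_cts cQ c1)]).
    apply: (@closed_forall _ ('cV[R]_n * R)%type (fun y X => dot y X.1 <= 1 + X.2) K) => y _.
    apply: closed_cts_le; first by apply: dot_cts => //; exact: cst_cts.
    by apply: add_cts => //; exact: cst_cts.
  - move=> [u f] /= [_ [_ [u1 [_ [f0 f1]]]]]; split; last by rewrite /= in_itv/= f0 f1.
    by move=> i j; rewrite ord1 (le_trans (enorm_coord _ _)).
have [S0|S0] := pselect (S !=set0); last first.
  exists 1 => // u u1 Ku; rewrite ltNge; apply/negP => Qu; apply: S0.
  by exists (u, 1); rewrite /S /= u1; do !split.
have [[u0 f0] [/= Ku0 [Qu0 [u01 [u01' [f00 f01]]]]] fmin] := compact_argmin S0 cS c2.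
have u0n : enorm u0 = 1 by apply/eqP; rewrite eq_le u01 u01'.
have f0p : 0 < f0.
  rewrite lt_def f00 andbT; apply/eqP => f0E; rewrite f0E in Ku0 Qu0.
  have /QU : contact K u0 by split=> // y /Ku0; rewrite addr0.
  by rewrite ltNge Qu0.
exists (f0 / 2); first by rewrite divr_gt0.
move=> u u1 Ku; rewrite ltNge; apply/negP => Qu.
have : S (u, f0 / 2) by rewrite /S /= u1; do !split => //; lra.
by move=> /fmin /=; lra.
Qed.

Lemma small_step (x q ta phi c1 c2 : R) : 0 < ta -> 0 < phi ->
  0 <= q -> 0 <= c1 -> 0 <= c2 -> 0 <= x ->
  exists e, [/\ 0 < e, e <= 1, e * q < phi, e * c1 < 1 /\ e * c2 < 1 & e * x < ta].
Proof.
move=> ta0 phi0 q0 c10 c20 x0.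
pose W := q + c1 + c2 + x; pose th := Num.min 1 (Num.min phi ta).
have W0 : 0 <= W by rewrite /W !addr_ge0.
have W1 : 0 < 1 + W by rewrite ltr_wpDr.
have th0 : 0 < th by rewrite !lt_min ltr01 phi0 ta0.
have e0 : 0 < th / (1 + W) by rewrite divr_gt0.
have eW : th / (1 + W) * (1 + W) = th by rewrite divfK// gt_eqF.
have [t1 t2 t3] : [/\ th <= 1, th <= phi & th <= ta] by rewrite /th !ge_min !lexx !orbT.
have small X : X <= W -> th / (1 + W) * X < th.
  move=> XW; rewrite -[Y in _ < Y]eW ltr_pM2l//.
  by apply: le_lt_trans XW _; rewrite ltrDr.
exists (th / (1 + W)); split=> //.
- by apply: le_trans t1; rewrite ler_pdivrMr// ler_peMr ?(ltW th0)// lerDl.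
- by apply: lt_le_trans (small _ _) t2; rewrite /W; lra.
- by split; apply: lt_le_trans (small _ _) t1; rewrite /W; lra.
- by apply: lt_le_trans (small _ _) t3; rewrite /W; lra.
Qed.

(** First-order expansion in [e] of the determinant of [1 - e (a 1 + w z^T)],
    with [p = <w, z>]. *)
Lemma det_perturb_gt1 n (e a p : R) : 0 < e -> e * a < 1 -> e * (a + p) < 1 ->
  e * (n%:R * (`|a| * `|a + p|)) < - (n.+1%:R * a + p) ->
  1 < (1 - e * a) ^+ n * (1 - e * (a + p)).
Proof.
move=> e0 ea1 ea2 enap.
have B1 : 1 - n%:R * (e * a) <= (1 - e * a) ^+ n.
  by have := @bernoulli R n (- (e * a)); rewrite mulrN; apply; rewrite lerN2 ltW.
have f2 : 0 < 1 - e * (a + p) by rewrite subr_gt0.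
apply: lt_le_trans (ler_wpM2r (ltW f2) B1).
have h1 : - (n%:R * (`|a| * `|a + p|)) <= n%:R * (a * (a + p)).
  by rewrite -mulrN ler_wpM2l// -normrM lerNl -normrN ler_norm.
have h2 : 0 < e * (- (n.+1%:R * a + p) + e * (n%:R * (a * (a + p)))).
  apply: mulr_gt0 => //; apply: (@lt_le_trans _ _
    (- (n.+1%:R * a + p) - e * (n%:R * (`|a| * `|a + p|)))).
    by rewrite subr_gt0.
  by rewrite lerD2l -mulrN ler_pM2l.
have -> : (1 - n%:R * (e * a)) * (1 - e * (a + p)) = 1 +
  e * (- (n.+1%:R * a + p) + e * (n%:R * (a * (a + p)))) by rewrite -natr1; ring.
by rewrite ltrDl.
Qed.

(** First-order expansion in [e] of the support function of the perturbed ball. *)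
Lemma support_perturb n (z w b g v : 'cV[R]_n) (e a : R) :
  enorm g = 1 -> enorm v <= 1 ->
  dot g (e *: b + ((1 - e * a)%:M + ((- e) *: w) *m z^T) *m v) <=
  1 - e * (a + dot z g * dot w g - dot b g) +
    e * (e * (`|a| + enorm z * enorm w) ^+ 2) / 2.
Proof.
move=> g1 v1; have gg := enorm1_dot g1.
set A : 'M[R]_n := _ + _.
have [h hE] : exists h, h = (1 - e * a) *: g - (e * dot w g) *: z.
  by exists ((1 - e * a) *: g - (e * dot w g) *: z).
have ATg : A^T *m g = h.
  rewrite /A linearD /= tr_scalar_mx trmx_mul trmxK mulmxDl mul_scalar_mx.
  have -> : ((- e) *: w)^T = (- e) *: w^T by apply/matrixP => i j; rewrite !mxE.
  by rewrite -scalemxAr -scalemxAl mulmx_dot scalerA hE mulNr scaleNr.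
have gAv : dot g (A *m v) <= enorm h.
  rewrite dotC dot_mulmxl dotC ATg; apply: le_trans (dot_le _ _) _.
  by rewrite ler_piMr// enorm_ge0.
set C := (_ + _) ^+ 2.
have hh : dot h h <= 1 - 2 * e * (a + dot z g * dot w g) + e ^+ 2 * C.
  have -> : dot h h = 1 - 2 * e * (a + dot z g * dot w g) +
     e ^+ 2 * dot (a *: g + dot w g *: z) (a *: g + dot w g *: z).
    by rewrite hE !dotE gg (dotC g z); ring.
  rewrite lerD2l; apply: ler_wpM2l; first exact: sqr_ge0.
  rewrite -enorm_le ?addr_ge0 ?mulr_ge0 ?enorm_ge0//.
  apply: le_trans (enormD _ _) _; rewrite !enormZ g1 mulr1 lerD2l mulrC.
  by apply: ler_wpM2l; [exact: enorm_ge0|have := dot_abs_le w g; rewrite g1 mulr1].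
(* [sqrt X <= (1 + X) / 2] *)
have hle : enorm h <= (1 + dot h h) / 2.
  rewrite -enorm_sq; move: (enorm h) => X.
  by have := sqr_ge0 (X - 1); rewrite sqrrB1; lra.
rewrite dotDr dotZr [dot g b]dotC.
apply: le_trans (lerD (lexx _) (le_trans gAv hle)) _.
move: hh; rewrite expr2 -(mulrA e e C); move: (dot h h) (e * C) => X Y; lra.
Qed.

(** John's theorem in dual form.  In a John decomposition
    [sum_i la_i u_i u_i^T = 1], [sum_i la_i u_i = 0] over contact points, summing
    [la_i (al - <z, u_i>) (be - <w, u_i>) >= 0] gives the conclusion; here it is
    obtained without the decomposition.  If the conclusion fails, the quadratic
    function [Q u = (al - <z, u>) (be - <w, u>) + de] is positive on the contact
    points while its homogeneous part [a 1 + w z^T] has negative trace.  Then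
    for small [e] the ellipsoid with centre [e (al w + be z)] and matrix
    [1 - e (a 1 + w z^T)] has a determinant larger than one.  It still lies in
    [K]: in the direction [g] its support function is at most
    [1 - e Q g + O (e ^ 2)], which is below one where [Q] is positive, and
    elsewhere the support function of [K] exceeds one by a fixed amount. *)
Lemma john_position_dual n (K : set 'cV[R]_n) (z w : 'cV[R]_n) (al be : R) :
  (0 < n)%N -> john_position K ->
  (forall u, contact K u -> dot z u <= al) ->
  (forall u, contact K u -> dot w u <= be) ->
  0 <= n%:R * al * be + dot z w.
Proof.
case: n K z w => // n K z w _ [cK vK BK Kmax] zal wbe.
rewrite leNgt; apply/negP; set s := _ + _ => s0.
have n0 : 0 < n.+1%:R :> R by rewrite ltr0n.
pose de := - s / (2 * n.+1%:R).
have de0 : 0 < de by rewrite divr_gt0 ?oppr_gt0// mulr_gt0.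
have [a aE] : exists a, a = al * be + de by exists (al * be + de).
have [p pE] : exists p, p = dot w z by exists (dot w z).
have tau0 : 0 < - (n.+1%:R * a + p).
  rewrite aE pE dotC mulrDr addrAC mulrA -/s /de.
  have -> : n.+1%:R * (- s / (2 * n.+1%:R)) = - s / 2 by field; rewrite gt_eqF.
  by rewrite -[s in s + _]addr0; lra.
pose b := al *: w + be *: z.
pose Q (u : 'cV[R]_n.+1) := a * dot u u + dot z u * dot w u - dot b u.
have QU u : contact K u -> 0 < Q u.
  move=> uU; have [u1 _] := uU.
  rewrite /Q (enorm1_dot u1) mulr1 /b dotDl !dotZl aE.
  have -> : al * be + de + dot z u * dot w u - (al * dot w u + be * dot z u) =
    (al - dot z u) * (be - dot w u) + de by ring.
  by rewrite ltr_wpDl// mulr_ge0// subr_ge0; [exact: zal|exact: wbe].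
have cQ : continuous Q.
  apply: add_cts; first apply: add_cts.
  - by apply: mul_cts; [exact: cst_cts|apply: dot_cts; exact: id_cts].
  - by apply: mul_cts; (apply: dot_cts; [exact: cst_cts|exact: id_cts]).
  - by apply: opp_cts; apply: dot_cts; [exact: cst_cts|exact: id_cts].
have [phi phi0 Hphi] := contact_gap cQ QU.
pose C := (`|a| + enorm z * enorm w) ^+ 2.
pose Qm := `|a| + enorm z * enorm w + enorm b.
have C0 : 0 <= C by exact: sqr_ge0.
have zw0 : 0 <= enorm z * enorm w by rewrite mulr_ge0 ?enorm_ge0.
have Qm0 : 0 <= Qm by rewrite !addr_ge0 ?enorm_ge0.
have [e [e0 e1 eQC eaa enap]] : exists e : R, [/\ 0 < e, e <= 1, e * (Qm + C) < phi,
    e * `|a| < 1 /\ e * `|a + p| < 1 &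
    e * (n%:R * (`|a| * `|a + p|)) < - (n.+1%:R * a + p)].
  by apply: small_step => //; exact: addr_ge0.
have [ea1 ea2] : e * a < 1 /\ e * (a + p) < 1.
  by split; [apply: le_lt_trans eaa.1|apply: le_lt_trans eaa.2]; rewrite ler_pM2l// ler_norm.
pose A : 'M[R]_n.+1 := (1 - e * a)%:M + ((- e) *: w) *m z^T.
have [AK|] := pselect (ellipsoid (e *: b) A `<=` K).
  have det1 : 1 < \det A.
    rewrite /A det_scalar_rank1; last by rewrite gt_eqF// subr_gt0.
    rewrite dotZr [dot z w]dotC -pE.
    have -> : 1 - e * a + (- e) * p = 1 - e * (a + p) by ring.
    exact: det_perturb_gt1.
  have d0 : 0 < \det A := lt_trans ltr01 det1.
  have uA : A \in unitmx by rewrite unitmxE unitfE gt_eqF.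
  by have := Kmax _ A uA AK; rewrite gtr0_norm// leNgt det1.
move=> /existsNP[x /not_implyP[[v + <-] Kx]]; rewrite eball0E => v1.
have K0 : K !=set0 by exists 0; apply: BK; rewrite eball0E enorm0.
have [g g1 [y0 Ky0 Hg]] := separation cK vK K0 Kx.
have gg := enorm1_dot g1.
have gy0 : 1 <= dot g y0.
  have Kg : K g by apply: BK; rewrite eball0E g1.
  by have /andP[] := Hg _ Kg; rewrite gg.
have gx : dot g y0 < dot g (e *: b + A *m v) by have /andP[] := Hg _ Ky0.
have := support_perturb z w b e a g1 v1; rewrite -/A -/C.
have -> : a + dot z g * dot w g - dot b g = Q g by rewrite /Q gg mulr1.
move=> gle; have := lt_le_trans gx gle; apply/negP; rewrite -leNgt.
have eC0 : 0 <= e * C by rewrite mulr_ge0// ltW.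
have eeC : e * (e * C) <= e * C by rewrite ler_piMl.
have [Kg|] := pselect (forall y, K y -> dot y g <= 1 + phi).
  have h1 : e * phi <= e * Q g by rewrite ler_pM2l// ltW// Hphi.
  have h2 : e * (e * C) <= e * phi.
    by rewrite ler_pM2l// ltW//; apply: le_lt_trans eQC; rewrite ler_pM2l// lerDr.
  have h3 : 0 <= e * (e * C) by rewrite mulr_ge0// ltW.
  apply: le_trans gy0; move: h1 h2 h3; clear; lra.
move=> /existsNP[y /not_implyP[Ky /negP]]; rewrite -ltNge => gy.
have gy' : 1 + phi < dot g y0.
  by apply: lt_le_trans gy _; rewrite dotC; have /andP[] := Hg _ Ky.
have QQ : - Qm <= Q g.
  have [zg [wg bg]] : `|dot z g| <= enorm z /\ `|dot w g| <= enorm w /\ `|dot b g| <= enorm b.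
    by do !split; rewrite -[X in _ <= X]mulr1 -g1 dot_abs_le.
  rewrite lerNl (le_trans (ler_norm _))// normrN /Q gg mulr1.
  apply: le_trans (ler_normD _ _) _; rewrite normrN; apply: lerD => //.
  apply: le_trans (ler_normD _ _) _; rewrite lerD2l normrM.
  exact: ler_pM.
apply: (ltW (le_lt_trans _ gy')).
have h1 : e * - Qm <= e * Q g by rewrite ler_pM2l.
move: h1 eeC eQC eC0; clear; rewrite mulrDr; lra.
Qed.

End John.

(** * John asymmetry *)

Section JohnAsymmetry.
Context {R : realType}.

(** [K] seen in the coordinates in which [ellipsoid c A] is the unit ball. *)
Definition affine_preim n (c : 'cV[R]_n) (A : 'M[R]_n) (K : set 'cV[R]_n) :=
  [set y | K (c + A *m y)].

Lemma affine_preim_compact n (c : 'cV[R]_n) A K : A \in unitmx -> compact K ->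
  compact (affine_preim c A K).
Proof.
move=> uA cK.
have -> : affine_preim c A K = (fun x => invmx A *m (x - c)) @` K.
  apply/seteqP; split=> [y Ky|_ [x Kx <-]].
    by exists (c + A *m y) => //; rewrite addrAC subrr add0r mulKmx.
  by rewrite /affine_preim /= mulKVmx// addrC subrK.
apply: continuous_compact => //; apply: continuous_subspaceT.
apply: mulmx_cts; first exact: cst_cts.
by apply: mxB_cts; [exact: id_cts|exact: cst_cts].
Qed.

Lemma affine_preim_convex n (c : 'cV[R]_n) A K :
  convex_set K -> convex_set (affine_preim c A K).
Proof.
move=> /convex_setP vK; apply/convex_setP => x y t Kx Ky t01.
rewrite /affine_preim /=.
have -> : c + A *m (t *: x + (1 - t) *: y) = t *: (c + A *m x) + (1 - t) *: (c + A *m y).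
  rewrite mulmxDr -!scalemxAr !scalerDr addrACA -scalerDl.
  by rewrite addrC [t + _]addrC subrK scale1r addrC.
exact: vK.
Qed.

Lemma john_position_preim n (K : set 'cV[R]_n) : convex_body K ->
  exists2 A, A \in unitmx & john_position (affine_preim (john_center K) A K).
Proof.
move=> bK; have [cK vK _] := bK.
have [c0 [A0 [uA0 AK0 A0max]]] := max_det_ellipsoid bK.
have JE : is_john_ellipsoid K (john_ellipsoid K).
  apply: (@xgetPex _ set0 [set E | is_john_ellipsoid K E]).
  exists (ellipsoid c0 A0); split=> //; first by exists c0, A0.
  move=> _ [c [A [uA ->]]] AK; rewrite volume_ellipsoid_le//; exact: A0max AK.
have [[c1 [A1 [uA1 E1]]] EK Emax] := JE.
have [A [uA EA]] : exists A, A \in unitmx /\ john_ellipsoid K = ellipsoid (john_center K) A.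
  rewrite /john_center /ellipsoid_center.
  apply: (@xgetPex _ 0 [set c | exists A, A \in unitmx /\ john_ellipsoid K = ellipsoid c A]).
  by exists c1, A1.
set c := john_center K in EA *.
exists A => //; split.
- exact: affine_preim_compact.
- exact: affine_preim_convex.
- by move=> y yB; apply: EK; rewrite EA; exists y.
- move=> c' A' uA' AK'.
  have AAK : ellipsoid (c + A *m c') (A *m A') `<=` K.
    move=> _ [x xB <-]; have : affine_preim c A K (c' + A' *m x) by apply: AK'; exists x.
    by rewrite /affine_preim /= mulmxDr mulmxA addrA.
  have uAA : A *m A' \in unitmx by rewrite unitmx_mul uA uA'.
  have := Emax _ _ AAK; rewrite EA volume_ellipsoid_le// => /(_ _)/wrap[].
    by exists (c + A *m c'), (A *m A').
  rewrite det_mulmx normrM ger_pMr// normr_gt0.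
  by rewrite -unitfE -unitmxE.
Qed.

(** This is [K `<=` - rho K], written with [rho^-1] because the set of admissible
    [rho^-1] is compact when the ones near zero are excluded. *)
Definition reflects n (K : set 'cV[R]_n) (rho : R) :=
  forall y, K y -> K (- (rho^-1 *: y)).

(** For [y] in [K] the dual form of John's theorem applied to [y] and to the point
    of the unit sphere opposite to [y] gives [|y| <= n]. *)
Lemma john_reflects_dim n (K : set 'cV[R]_n) : (0 < n)%N -> john_position K ->
  reflects K n%:R.
Proof.
move=> n0 JK y Ky; have [cK vK BK _] := JK.
have nR : 0 < n%:R :> R by rewrite ltr0n.
apply: (BK); rewrite eball0E enormN enormZ gtr0_norm ?invr_gt0// mulrC ler_pdivrMr// mul1r.
have [->|y0] := eqVneq y 0; first by rewrite enorm0 ler0n.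
pose v := - ((enorm y)^-1 *: y).
have Kv : K v by apply: BK; rewrite eball0E enormN enorm_normalize.
have := @john_position_dual _ _ K y v 1 1 n0 JK (fun u uU => uU.2 _ Ky) (fun u uU => uU.2 _ Kv).
have -> : dot y v = - enorm y.
  by rewrite dotNr dotZr -enorm_sq expr2 mulKf// enorm_eq0.
by rewrite !mulr1 subr_ge0.
Qed.

(** A point of maximal norm cannot be sent by [- rho^-1] to a point of larger
    norm, hence the bound from below.  The infimum is attained because the
    admissible [rho^-1] at least [n^-1] form a compact set. *)
Lemma john_asymmetry_spec n (K : set 'cV[R]_n) A : (0 < n)%N ->
  A \in unitmx -> let K' := affine_preim (john_center K) A K in john_position K' ->
  [/\ 1 <= john_asymmetry K, john_asymmetry K <= n%:R & reflects K' (john_asymmetry K)].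
Proof.
move=> n0 uA K' JK'; set c := john_center K in K' JK' *.
have nR : 0 < n%:R :> R by rewrite ltr0n.
have n1 : 1 <= n%:R :> R by rewrite ler1n.
have [cK' vK' BK' _] := JK'.
have K'E x : K x -> K' (invmx A *m (x - c)).
  by move=> Kx; rewrite /K' /affine_preim /= mulKVmx// addrC subrK.
pose F : set R := [set rho | 0 <= rho /\
    [set x - c | x in K] `<=` [set rho *: (c - x) | x in K]].
have FE rho : F rho <-> 1 <= rho /\ reflects K' rho.
  split=> [[rho0 HF]|[rho1 HF]].
    have HK' y : K' y -> exists2 y', K' y' & y = - (rho *: y').
      move=> Ky; have : [set x - c | x in K] (A *m y).
        by exists (c + A *m y) => //; rewrite addrAC subrr add0r.
      move=> /HF[x Kx xE]; exists (invmx A *m (x - c)); first exact: K'E.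
      rewrite -[LHS](mulKmx uA) -xE -scalemxAr -scalerN -mulmxN opprB.
      by rewrite scalemxAr.
    have K'0 : K' !=set0 by exists 0; apply: BK'; rewrite eball0E enorm0.
    have [|y0 Ky0 ymax] := compact_argmin (f := fun x : 'cV[R]_n => - enorm x) K'0 cK'.
      by apply: opp_cts; apply: enorm_cts; exact: id_cts.
    have y01 : 1 <= enorm y0.
      pose e : 'cV[R]_n := delta_mx (Ordinal n0) 0.
      have /ymax : K' e by apply: BK'; exact: delta_eball.
      rewrite lerN2; apply: le_trans; rewrite enormE /dot (bigD1 (Ordinal n0))//= big1 ?addr0.
        by rewrite !mxE !eqxx mulr1 sqrtr1.
      by move=> i i0; rewrite mxE (negbTE i0) mul0r.
    have [y' Ky' yE] := HK' _ Ky0.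
    have rho1 : 1 <= rho.
      have := ymax _ Ky'; rewrite lerN2 => y'y.
      have := congr1 (@enorm R n) yE; rewrite enormN enormZ ger0_norm// => E.
      rewrite -(@ler_pM2r _ (enorm y0)) ?mul1r; last lra.
      by rewrite [X in X <= _]E ler_wpM2l.
    split=> // y /HK'[y2 Ky2 ->].
    by rewrite scalerN opprK scalerA mulVf ?scale1r// gt_eqF//; lra.
  have rho0 : 0 < rho by lra.
  split; first exact: ltW.
  move=> _ [x Kx <-]; have := HF _ (K'E _ Kx).
  rewrite /K' /affine_preim /= mulmxN -scalemxAr mulKVmx// => Kx'.
  exists (c - rho^-1 *: (x - c)) => //.
  by rewrite opprB addrC subrK scalerA divff ?scale1r// gt_eqF.
pose G := [set tau : R | (forall y, K' y -> K' (- (tau *: y))) /\ (n%:R^-1 <= tau /\ tau <= 1)].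
have cG : compact G.
  apply: (@subclosed_compact _ G `[n%:R^-1, 1]%classic).
  - apply: closed_setAnd; last apply: closed_setAnd.
    + apply: (@closed_forall _ R (fun y t => K' (- (t *: y))) K') => y _.
      apply: (closed_cts _ (cV_compact_closed cK')).
      rewrite (_ : (fun t => _) = (fun t : R => (- t) *: y)); last first.
        by apply/funext => t; rewrite scaleNr.
      by apply: mxZ_cts; [apply: opp_cts; exact: id_cts|exact: cst_cts].
    + by apply: closed_cts_le; [exact: cst_cts|exact: id_cts].
    + by apply: closed_cts_le; [exact: id_cts|exact: cst_cts].
  - exact: segment_compact.
  - by move=> t [_ [t0 t1]]; rewrite /= in_itv/= t0 t1.
have G0 : G n%:R^-1.
  by split; [exact: john_reflects_dim|rewrite lexx invf_le1].
have [tau [HG [tau0 tau1]] taumin] := compact_argmin (ex_intro _ _ G0) cG (f :=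
  fun t => - t) (opp_cts (@id_cts _)).
have tau00 : 0 < tau by apply: lt_le_trans tau0; rewrite invr_gt0.
have -> : john_asymmetry K = tau^-1.
  rewrite /john_asymmetry -/c -/F.
  have Ft : F tau^-1 by apply/FE; rewrite invf_ge1//; split=> // y Ky; rewrite invrK; exact: HG.
  apply/eqP; rewrite eq_le; apply/andP; split.
    by apply: ge_inf Ft; exists 0 => rho [].
  apply: lb_le_inf; first by exists tau^-1.
  move=> rho /FE[rho1 Hr]; have rho0 : 0 < rho by apply: lt_le_trans rho1.
  rewrite -[X in _ <= X]invrK lef_pV2 ?posrE ?invr_gt0//.
  have [rn|/ltW nr] := leP rho n%:R; last first.
    by apply: le_trans tau0; rewrite lef_pV2 ?posrE.
  have : G rho^-1 by split=> //; rewrite lef_pV2 ?posrE// rn invf_le1.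
  by move=> /taumin; rewrite lerN2.
split.
- by rewrite invf_ge1.
- by rewrite -[X in _ <= X]invrK lef_pV2// posrE invr_gt0.
- by move=> y Ky; rewrite invrK; exact: HG.
Qed.

(** On contact points [- s <= <x, u> <= 1], so that [john_position_dual] gives
    [|x| ^ 2 <= n s], and likewise for [y]; it also gives [<x, y> >= - n]. *)
Lemma john_position_diam n (K : set 'cV[R]_n) s x y : (0 < n)%N ->
  john_position K -> 0 < s -> reflects K s -> K x -> K y ->
  enorm (x - y) <= Num.sqrt (2 * n%:R * (s + 1)).
Proof.
move=> n0 JK s0 Ks Kx Ky.
have U1 z : K z -> forall u, contact K u -> dot z u <= 1.
  by move=> Kz u uU; exact: uU.2.
have Us z : K z -> forall u, contact K u -> dot (- z) u <= s.
  move=> Kz u uU; have := uU.2 _ (Ks _ Kz).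
  by rewrite !dotNl dotZl -mulrN mulrC ler_pdivrMr// mul1r.
have L := @john_position_dual _ n K.
have := L x y 1 1 n0 JK (U1 _ Kx) (U1 _ Ky).
have := L x (- x) 1 s n0 JK (U1 _ Kx) (Us _ Kx).
have := L y (- y) 1 s n0 JK (U1 _ Ky) (Us _ Ky).
rewrite !dotNr => h1 h2 h3.
rewrite enormE ler_wsqrtr// !dotE (dotC y x); lra.
Qed.

End JohnAsymmetry.

(** * The planar diameter bound *)

Section Planar.
Context {R : realType}.

(** The case [p >= p0 + q S / C]: the centre [(p0, 0)] satisfies the same
    constraints as [(p, q)]. *)
Lemma planar_shift (C S p0 p q t c sg : R) : 0 < p0 -> 0 < C -> 0 < S ->
  0 <= q -> p0 * C + q * S <= p * C -> t * `|sg| <= 1 + p0 * C ->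
  C < `|c| -> `|sg| < S ->
  p * c + (q + t) * sg <= 1 -> p * c + (q - t) * sg <= 1 ->
  p0 * c + t * `|sg| <= 1.
Proof.
move=> p00 C0 S0 q0 pq tw; have [c0|c0] := leP c 0.
  rewrite ler0_norm// => Cc _ _ _.
  have : p0 * C <= p0 * - c by rewrite ler_pM2l// ltW.
  lra.
rewrite gtr0_norm// => Cc.
have qS0 : 0 <= q * S by rewrite mulr_ge0// ltW.
have pp0 : p0 <= p by rewrite -(ler_pM2r C0); apply: le_trans pq; rewrite lerDl.
have pc : p0 * c <= p * c by rewrite ler_pM2r.
have [sg0|sg0] := leP 0 sg.
  rewrite ger0_norm// => _ HX _.
  have : 0 <= q * sg by rewrite mulr_ge0.
  lra.
rewrite ltr0_norm// => Ss _ HY.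
have h1 : q * - sg <= q * S by rewrite ler_wpM2l// ltW.
have h2 : (p - p0) * C <= (p - p0) * c by rewrite ler_wpM2l ?subr_ge0// ltW.
lra.
Qed.

(** Otherwise the end point [(p, q - t0)] is moved by [- nu (S, C)].  Contact
    normals with [c > 0] make an acute angle with [(S, C)], so that their
    constraints are preserved; among those with [c < 0] the critical position is
    the corner [(- C, - S)], where equality determines [nu]. *)
Lemma planar_tilt (C S t0 p0 p q t nu c sg : R) : 0 < C -> 0 < S ->
  0 <= p -> 0 <= q -> q <= t0 -> t0 <= t -> 0 <= t0 ->
  t0 * S = 1 + p0 * C -> 0 <= nu -> 2 * (S * C) * nu = q * S + (p - p0) * C ->
  nu * S <= p / 2 -> C <= `|c| -> `|sg| <= S ->
  p * c + (q + t) * sg <= 1 -> p * c + (q - t) * sg <= 1 ->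
  (p - nu * S) * c + (q - t0 - nu * C) * sg <= 1.
Proof.
move=> C0 S0 p_0 q0 qt0 tt0 t00 tS nu0 nuE nuS.
have pnu : 0 <= p - nu * S by lra.
have nuC : 0 <= nu * C by rewrite mulr_ge0// ltW.
have tq : 0 <= t0 + nu * C - q by lra.
have [c0|c0] := leP c 0.
  rewrite ler0_norm// => Cc Ss _ _.
  have h1 : (p - nu * S) * C <= (p - nu * S) * - c by rewrite ler_wpM2l.
  have [sg0|sg0] := leP 0 sg.
    have h2 : 0 <= (t0 + nu * C - q) * sg by rewrite mulr_ge0.
    have h3 : 0 <= (p - nu * S) * C by rewrite mulr_ge0// ltW.
    lra.
  rewrite ltr0_norm// in Ss.
  have h2 : (t0 + nu * C - q) * - sg <= (t0 + nu * C - q) * S by rewrite ler_wpM2l.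
  have h3 : (t0 + nu * C - q) * S - (p - nu * S) * C = 1.
    have -> : (t0 + nu * C - q) * S - (p - nu * S) * C =
      2 * (S * C) * nu + t0 * S - q * S - p * C by ring.
    by rewrite nuE tS; ring.
  lra.
rewrite gtr0_norm// => Cc Ss HX HY.
have h1 : p * c + (q - t0) * sg <= 1.
  have [sg0|sg0] := leP 0 sg.
    have : 0 <= (t + t0) * sg by rewrite mulr_ge0// addr_ge0// (le_trans t00).
    lra.
  have : 0 <= (t - t0) * - sg by rewrite mulr_ge0 ?subr_ge0// oppr_ge0 ltW.
  lra.
have h2 : 0 <= nu * (S * c + C * sg).
  apply: mulr_ge0 => //.
  have h3 : S * C <= S * c by rewrite ler_pM2l.
  have h4 : C * - sg <= C * S by rewrite ler_pM2l// (le_trans (ler_norm _))// normrN.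
  lra.
lra.
Qed.

(** The gain obtained by the tilt, with the common denominator [2 S C] cleared:
    it is affine in [p - p0] up to a nonnegative term, with nonnegative values at
    both ends when [p0 <= p]; when [p < p0] the worst angle is [S = C]. *)
Lemma planar_gain (C S t0 p0 p q : R) : 0 < p0 -> 0 < C -> 0 < S ->
  C <= S -> p0 * S <= t0 * C -> 0 <= p -> 0 <= q -> 4 * q <= t0 ->
  p * C <= p0 * C + q * S -> (p < p0 -> p0 - p <= q) ->
  2 * (S * C) * (p ^+ 2 + q ^+ 2 - p0 ^+ 2) <=
  (q * S + (p - p0) * C) * (p * S + (q + t0) * C).
Proof.
move=> p00 C0 S0 CS pStC p_0 q0 qt pqC jq; rewrite -subr_ge0.
have SC0 : 0 < S * C by apply: mulr_gt0.
have tq : 0 <= t0 - q by lra.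
have [pp0|pp0] := leP p0 p.
  have [k kE] : exists k, k = p - p0 by exists (p - p0).
  have k0 : 0 <= k by rewrite kE subr_ge0.
  have kqS : 0 <= q * S - k * C by rewrite kE; lra.
  have -> : (q * S + (p - p0) * C) * (p * S + (q + t0) * C) -
      2 * (S * C) * (p ^+ 2 + q ^+ 2 - p0 ^+ 2)
    = p * S * (q * S - k * C) +
      (q * (t0 - q) * (S * C) + k * ((q + t0) * C ^+ 2 - 2 * (S * C) * p0)).
    by rewrite kE; ring.
  apply: addr_ge0; first by rewrite mulr_ge0// mulr_ge0// ltW.
  clear jq pqC kE pp0 p_0.
  have := q0; rewrite le_eqVlt => /predU1P[q00|qp].
    have -> : k = 0.
      apply/eqP; rewrite eq_le k0 andbT -(ler_pM2r C0) mul0r.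
      by move: kqS; rewrite -q00 mul0r sub0r oppr_ge0.
    by rewrite -q00 !mul0r addr0.
  have qS0 : 0 < q * S by rewrite mulr_gt0.
  rewrite -(pmulr_rge0 _ qS0).
  have -> : q * S * (q * (t0 - q) * (S * C) + k * ((q + t0) * C ^+ 2 - 2 * (S * C) * p0)) =
    (q * S - k * C) * (q * (t0 - q) * (S * C)) + k * C * (2 * (q * S)) * (t0 * C - p0 * S).
    by ring.
  apply: addr_ge0.
    by apply: mulr_ge0 => //; apply: mulr_ge0; [exact: mulr_ge0|exact: ltW].
  apply: mulr_ge0; last by rewrite subr_ge0.
  apply: mulr_ge0; first by apply: mulr_ge0 => //; exact: ltW.
  by apply: mulr_ge0 => //; exact: ltW.
have [j jE] : exists j, j = p0 - p by exists (p0 - p).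
have qj : j <= q by rewrite jE; exact: jq.
have j0 : 0 < j by rewrite jE subr_gt0.
have jp0 : j <= p0 by lra.
have -> : (q * S + (p - p0) * C) * (p * S + (q + t0) * C) -
    2 * (S * C) * (p ^+ 2 + q ^+ 2 - p0 ^+ 2)
  = q * p * (S * (S - C)) + j * (q + t0) * (C * (S - C)) + S * C *
     ((q - j) * (t0 + p0 - 4 * j - (q - j)) + 4 * j * (p0 - j)).
  by rewrite jE; ring.
clear jq pqC jE pp0.
have SC1 : 0 <= S - C by rewrite subr_ge0.
apply: addr_ge0; first apply: addr_ge0.
- by apply: mulr_ge0; [exact: mulr_ge0|apply: mulr_ge0 => //; exact: ltW].
- apply: mulr_ge0; last by apply: mulr_ge0 => //; exact: ltW.
  by apply: mulr_ge0; [exact: ltW|lra].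
- apply: mulr_ge0; first exact: ltW.
  apply: addr_ge0; first by apply: mulr_ge0; lra.
  by apply: mulr_ge0; [rewrite mulr_ge0// ltW|rewrite subr_ge0].
Qed.

(** [U] collects the coordinates [(c, sg)] of the contact normals of a planar
    body in John position; [planar_dual] is the only trace of that position.
    The segment with centre [(p, q)] and half-length [t] along the second axis
    satisfies the contact constraints.  If [t > t0], the width bound [HW] keeps
    the normals away from the second axis, beyond the corners [(+- C, +- S)],
    so that one end point can be moved to a place where its inner product with
    the other one violates [planar_dual]. *)
Lemma planar_core (U : R -> R -> Prop) (w t0 p0 C S p q t : R) :
  (forall c sg, U c sg -> c ^+ 2 + sg ^+ 2 = 1) ->
  (forall z1 z2 w1 w2,
    (forall c sg, U c sg -> z1 * c + z2 * sg <= 1) ->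
    (forall c sg, U c sg -> w1 * c + w2 * sg <= 1) ->
    0 <= 2 + (z1 * w1 + z2 * w2)) ->
  0 < t0 -> 0 < p0 -> 0 < C -> 0 < S ->
  p0 ^+ 2 = t0 ^+ 2 - 2 -> p0 * C = w - 1 -> t0 * S = w ->
  C ^+ 2 + S ^+ 2 = 1 -> C <= S -> p0 * S <= t0 * C ->
  0 <= p -> 0 <= q -> q * S <= p0 * C -> 4 * q <= t0 ->
  (forall c sg, U c sg -> p * c + (q + t) * sg <= 1) ->
  (forall c sg, U c sg -> p * c + (q - t) * sg <= 1) ->
  (forall c sg, U c sg -> t * `|sg| <= w) ->
  t <= t0.
Proof.
move=> Uunit planar_dual t00 p00 C0 S0 pt0 pC tS CS1 CS pStC pge0 qge0 qS qt HX HY HW.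
rewrite leNgt; apply/negP => tt0.
have tp : 0 < t := lt_trans t00 tt0.
have wE : w = 1 + p0 * C by rewrite pC addrC subrK.
have sgS c sg : U c sg -> `|sg| < S.
  move=> uU; rewrite -(ltr_pM2l tp); apply: le_lt_trans (HW _ _ uU) _.
  by rewrite -tS ltr_pM2r.
have cC c sg : U c sg -> C < `|c|.
  move=> uU; have := sgS _ _ uU.
  rewrite -(@ltr_sqr _ `|sg|) ?nnegrE ?(ltW S0)// -(@ltr_sqr _ C) ?nnegrE ?(ltW C0)//.
  by rewrite !real_normK ?num_real//; have := Uunit _ _ uU; lra.
have tt : t0 ^+ 2 < t ^+ 2 by rewrite ltr_sqr ?nnegrE ?(ltW t00) ?(ltW tp).
have [case1|/ltW case2] := leP (p0 * C + q * S) (p * C).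
  have B e c sg : `|e| = 1 -> U c sg -> p0 * c + (e * t) * sg <= 1.
    move=> e1 uU.
    have tw : t * `|sg| <= 1 + p0 * C by rewrite -wE; exact: (HW _ _ uU).
    have := planar_shift p00 C0 S0 qge0 case1 tw (cC _ _ uU) (sgS _ _ uU)
      (HX _ _ uU) (HY _ _ uU).
    apply: le_trans; rewrite lerD2l (le_trans (ler_norm _))// !normrM e1 mul1r.
    by rewrite gtr0_norm.
  have := planar_dual p0 (1 * t) p0 (-1 * t) (fun c sg => B 1 c sg (normr1 _))
    (fun c sg => B (-1) c sg (normrN1 _)).
  lra.
have Pge : t ^+ 2 - 2 <= p ^+ 2 + q ^+ 2.
  by have := planar_dual _ _ _ _ HX HY; lra.
(* when [p] falls short of [p0], the norm bound [Pge] forces [q] to compensate *)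
have jq : p < p0 -> p0 - p <= q.
  move=> pp0; have pp : 0 <= p0 - p by rewrite subr_ge0 ltW.
  rewrite -ler_sqr ?nnegrE//.
  have : (p0 - p) * p >= 0 by rewrite mulr_ge0.
  lra.
have gain := planar_gain p00 C0 S0 CS pStC pge0 qge0 qt case2 jq.
have kC : 0 <= q * S + (p - p0) * C.
  have [pp0|pp0] := leP p0 p.
    by apply: addr_ge0; apply: mulr_ge0; rewrite ?subr_ge0// ltW.
  have : (p0 - p) * C <= q * S.
    by apply: ler_pM; rewrite ?subr_ge0 ?jq// ltW.
  lra.
have SC0 : 0 < S * C by apply: mulr_gt0.
have [nu nu0 nuE] : exists2 nu, 0 <= nu & 2 * (S * C) * nu = q * S + (p - p0) * C.
  exists ((q * S + (p - p0) * C) / (2 * (S * C))).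
    by rewrite divr_ge0// mulr_ge0// ltW.
  by rewrite mulrC divfK// gt_eqF// mulr_gt0.
have nuS : nu * S <= p / 2.
  rewrite -(ler_pM2r C0).
  have -> : nu * S * C = (q * S + (p - p0) * C) / 2 by rewrite -nuE; field.
  lra.
have qt0 : q <= t0 by lra.
have tS' : t0 * S = 1 + p0 * C by rewrite tS.
have B c sg : U c sg -> (p - nu * S) * c + (q - t0 - nu * C) * sg <= 1.
  move=> uU; apply: (@planar_tilt C S t0 p0 p q t nu c sg) => //; try exact: ltW.
  - exact/ltW/cC/uU.
  - exact/ltW/sgS/uU.
  - exact: HX.
  - exact: HY.
have := planar_dual _ _ _ _ HX B.
rewrite leNgt => /negP; apply.
have h1 : 0 <= (t - t0) * (nu * C).
  by apply: mulr_ge0; [rewrite subr_ge0 ltW|apply: mulr_ge0 => //; exact: ltW].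
have h2 : 0 < (t - t0) * (t0 - q) by apply: mulr_gt0; lra.
have h3 : p ^+ 2 + q ^+ 2 - p0 ^+ 2 <= nu * (p * S + (q + t0) * C).
  by rewrite -(@ler_pM2l _ (2 * (S * C))) ?mulr_gt0// [X in _ <= X]mulrA nuE.
lra.
Qed.

(** With [w = (s + 1) / 2], the square [T] of half of [Dconst s] is the larger
    root of [X ^ 2 - (2 w ^ 2 - 2 w + 3) X + 2 w ^ 2]; the bounds are obtained
    by evaluating the quadratic, which is [- 4 (w - 1) ^ 3] up to a positive
    factor at the two lower ones. *)
Lemma Dconst_bounds (s : R) : 1 <= s <= 2 -> let w := (s + 1) / 2 in
  let t0 := Dconst s / 2 in let T := t0 ^+ 2 in
  [/\ 0 < t0, T ^+ 2 - (2 * w ^+ 2 - 2 * w + 3) * T + 2 * w ^+ 2 = 0,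
    2 * w ^+ 2 <= T * (2 * w - 1), 2 + 2 * (w - 1) ^+ 2 <= T & T <= 2 * w].
Proof.
move=> /andP[s1 s2] w t0 T.
pose De := 4 * (2 - s) ^+ 2 + (s ^+ 2 - 1) ^+ 2; pose r := Num.sqrt De.
have De0 : 0 <= De.
  by apply: addr_ge0; [apply: mulr_ge0 => //|]; exact: sqr_ge0.
have r0 : 0 <= r by exact: sqrtr_ge0.
have rr : r ^+ 2 = De by rewrite sqr_sqrtr.
have a0 : 0 < s ^+ 2 + 5 + r by have := sqr_ge0 s; lra.
have TE : T = (s ^+ 2 + 5 + r) / 4.
  by rewrite /T /t0 /Dconst -/De -/r expr_div_n sqr_sqrtr ?(ltW a0)//; field.
have t00 : 0 < t0 by rewrite divr_gt0// sqrtr_gt0.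
have wE : s = 2 * w - 1 by rewrite /w; field.
have [w1 w2] : 1 <= w /\ w <= 3 / 2 by rewrite /w; split; lra.
have fT X : X ^+ 2 - (2 * w ^+ 2 - 2 * w + 3) * X + 2 * w ^+ 2 =
    (X - T) * (X - (s ^+ 2 + 5 - r) / 4).
  have -> : (X - T) * (X - (s ^+ 2 + 5 - r) / 4) =
    X ^+ 2 - (s ^+ 2 + 5) / 2 * X + ((s ^+ 2 + 5) ^+ 2 - r ^+ 2) / 16.
    by rewrite TE; field.
  by rewrite rr /De wE; field.
have low X : X ^+ 2 - (2 * w ^+ 2 - 2 * w + 3) * X + 2 * w ^+ 2 <= 0 -> X <= T.
  rewrite fT => fX; rewrite leNgt; apply/negP => XT; move: fX; rewrite leNgt => /negP; apply.
  by rewrite mulr_gt0//; rewrite TE in XT *; lra.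
have w21 : 0 < 2 * w - 1 by lra.
have w3 : 0 <= (w - 1) ^+ 3 by rewrite exprn_ge0// subr_ge0.
split=> //.
- by rewrite fT subrr mul0r.
- rewrite -ler_pdivrMr//; apply: low.
  have -> : (2 * w ^+ 2 / (2 * w - 1)) ^+ 2 - (2 * w ^+ 2 - 2 * w + 3) * (2 * w ^+ 2 / (2 * w - 1)) + 2 * w ^+ 2
    = - (2 * w ^+ 2 * (4 * (w - 1) ^+ 3)) / (2 * w - 1) ^+ 2.
    by field; rewrite gt_eqF.
  rewrite mulNr oppr_le0 divr_ge0 ?sqr_ge0//.
  by apply: mulr_ge0; apply: mulr_ge0; rewrite ?sqr_ge0.
- apply: low.
  have -> : (2 + 2 * (w - 1) ^+ 2) ^+ 2 - (2 * w ^+ 2 - 2 * w + 3) * (2 + 2 * (w - 1) ^+ 2) + 2 * w ^+ 2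
    = - (4 * (w - 1) ^+ 3) by ring.
  by rewrite oppr_le0 mulr_ge0.
- rewrite leNgt; apply/negP => wT.
  have : 0 <= (2 * w - T) * (2 * w - (s ^+ 2 + 5 - r) / 4).
    rewrite -fT.
    have -> : (2 * w) ^+ 2 - (2 * w ^+ 2 - 2 * w + 3) * (2 * w) + 2 * w ^+ 2
      = 2 * w * (3 - 2 * w) * (w - 1) by ring.
    by rewrite !mulr_ge0//; lra.
  rewrite leNgt => /negP; apply; rewrite nmulr_rlt0 ?subr_lt0//.
  have : 0 < - s ^+ 2 + 4 * s - 1 by nra.
  by rewrite /w; lra.
Qed.

(** The extremal configuration: its contact normals with negative first
    coordinate are [(- C, +- S)], and the centre of its segment is at distance
    [p0] from the origin. *)
Lemma planar_params (w t0 : R) : 1 < w -> 0 < t0 ->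
  t0 ^+ 2 ^+ 2 - (2 * w ^+ 2 - 2 * w + 3) * t0 ^+ 2 + 2 * w ^+ 2 = 0 ->
  2 + 2 * (w - 1) ^+ 2 <= t0 ^+ 2 -> t0 ^+ 2 <= 2 * w ->
  exists p0 C S,
    [/\ 0 < p0, 0 < C & 0 < S] /\
    [/\ p0 ^+ 2 = t0 ^+ 2 - 2, p0 * C = w - 1, t0 * S = w,
        C ^+ 2 + S ^+ 2 = 1 & C <= S /\ p0 * S <= t0 * C].
Proof.
move=> w1 t00 fT T2 T3.
have w20 : 0 < (w - 1) ^+ 2 by rewrite exprn_gt0// subr_gt0.
have T0 : 0 < t0 ^+ 2 - 2 by lra.
have t02 : 0 < t0 ^+ 2 by rewrite exprn_gt0.
pose p0 := Num.sqrt (t0 ^+ 2 - 2).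
have p00 : 0 < p0 by rewrite sqrtr_gt0.
have pp0 : p0 ^+ 2 = t0 ^+ 2 - 2 by rewrite sqr_sqrtr// ltW.
pose C := (w - 1) / p0; pose S := w / t0.
have C0 : 0 < C by rewrite divr_gt0// subr_gt0.
have S0 : 0 < S by rewrite divr_gt0//; lra.
have pC : p0 * C = w - 1 by rewrite /C mulrC divfK// gt_eqF.
have tS : t0 * S = w by rewrite /S mulrC divfK// gt_eqF.
exists p0, C, S; split; split=> //.
  rewrite /C /S !expr_div_n pp0.
  have -> : (w - 1) ^+ 2 / (t0 ^+ 2 - 2) + w ^+ 2 / t0 ^+ 2 =
    ((w - 1) ^+ 2 * t0 ^+ 2 + w ^+ 2 * (t0 ^+ 2 - 2)) / ((t0 ^+ 2 - 2) * t0 ^+ 2).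
    by field; rewrite !gt_eqF.
  have -> : (w - 1) ^+ 2 * t0 ^+ 2 + w ^+ 2 * (t0 ^+ 2 - 2) = (t0 ^+ 2 - 2) * t0 ^+ 2.
    by apply/eqP; rewrite -subr_eq0 -[X in _ == X]oppr0 -fT; apply/eqP; ring.
  by rewrite divff// mulf_neq0// gt_eqF.
split.
  have CC : C ^+ 2 <= 2^-1 by rewrite /C expr_div_n pp0 ler_pdivrMr//; lra.
  have SS : 2^-1 <= S ^+ 2 by rewrite /S expr_div_n ler_pdivlMr//; nra.
  by rewrite -ler_sqr ?nnegrE ?(ltW C0) ?(ltW S0)//; apply: le_trans CC SS.
rewrite -(ler_pM2r (mulr_gt0 p00 t00)).
have -> : p0 * S * (p0 * t0) = p0 ^+ 2 * (t0 * S) by ring.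
have -> : t0 * C * (p0 * t0) = t0 ^+ 2 * (p0 * C) by ring.
by rewrite pp0 tS pC; lra.
Qed.

(** [e1] is [e] turned by a right angle. *)
Lemma planar_frame (e : 'cV[R]_2) : enorm e = 1 -> exists2 e1 : 'cV[R]_2,
  dot e1 e1 = 1 & forall u v, dot u v = dot e1 u * dot e1 v + dot e u * dot e v.
Proof.
move=> e1; have := enorm1_dot e1; rewrite /dot !big_ord_recl big_ord0 => ee.
exists (\col_i if i == 0 then e (lift ord0 ord0) 0 else - e 0 0).
  by rewrite /dot !big_ord_recl big_ord0 !mxE /= addr0 -ee; ring.
move=> u v; rewrite /dot !big_ord_recl !big_ord0 !mxE /= !addr0.
rewrite addr0 in ee; rewrite -[LHS]mul1r -ee; ring.
Qed.

(** The second coordinate axis is chosen along [x - y]; the sign condition and a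
    choice of orientation put the midpoint of the segment in the first
    quadrant. *)
Lemma john_position_diam2_aux (K : set 'cV[R]_2) s x y :
  john_position K -> 1 < s <= 2 -> reflects K s -> K x -> K y ->
  0 <= dot (x + y) (x - y) ->
  enorm (x - y) <= Dconst s.
Proof.
move=> JK /andP[s1 s2] Ks Kx Ky xy0.
have [|t00 fT T1 T2 T3] := @Dconst_bounds s; first by rewrite (ltW s1) s2.
set w := (s + 1) / 2 in fT T1 T2 T3; set t0 := Dconst s / 2 in t00 fT T1 T2 T3.
have [t0E wE] : Dconst s = 2 * t0 /\ 2 * w = s + 1 by split; rewrite /t0 /w; field.
clearbody t0 w.
have [m [d [xE yE xyE dm]]] : exists m d : 'cV[R]_2,
    [/\ x = m + d, y = m - d, x - y = 2 *: d & 0 <= dot d m].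
  exists (2^-1 *: (x + y)), (2^-1 *: (x - y)); split.
  - by apply/matrixP => i j; rewrite !mxE; field.
  - by apply/matrixP => i j; rewrite !mxE; field.
  - by rewrite scalerA mulfV ?scale1r.
  - by rewrite dotZl dotZr dotC !mulr_ge0.
have [t tE] : exists t, t = enorm d by exists (enorm d).
suff tt0 : t <= t0.
  by rewrite xyE enormZ ger0_norm// -tE t0E ler_pM2l.
rewrite leNgt; apply/negP => tt0.
have tp : 0 < t := lt_trans t00 tt0.
have w1 : 1 < w by lra.
have [e2 [e21 dE]] : exists e2, enorm e2 = 1 /\ d = t *: e2.
  exists (t^-1 *: d); rewrite tE enorm_normalize -?enorm_gt0 -?tE//; split=> //.
  by rewrite scalerA divff ?scale1r// gt_eqF.
have U1 z : K z -> forall u, contact K u -> dot z u <= 1 by move=> Kz u [_]; exact.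
have Us z : K z -> forall u, contact K u -> dot (- z) u <= s.
  move=> Kz u uU; have := uU.2 _ (Ks _ Kz).
  by rewrite !dotNl dotZl -mulrN mulrC ler_pdivrMr ?mul1r//; lra.
have Ud u : contact K u -> dot d u <= w /\ dot (- d) u <= w.
  move=> uU; rewrite dotNl.
  have : 2 * dot d u = dot x u - dot y u by rewrite -dotZl -xyE dotDl dotNl.
  have := U1 _ Kx u uU; have := U1 _ Ky u uU.
  have := Us _ Kx u uU; have := Us _ Ky u uU; rewrite !dotNl.
  by split; lra.
have main e1 (e11 : dot e1 e1 = 1) (E : forall u v, dot u v =
  dot e1 u * dot e1 v + dot e2 u * dot e2 v) :
    0 <= dot e1 m -> False.
  move=> pge0.
  have e12 : dot e1 e2 = 0.
    have := E e2 e2; rewrite (enorm1_dot e21) mulr1 => h.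
    by apply/eqP; rewrite -[_ == 0]orbb -mulf_eq0; apply/eqP; lra.
  have dotdm : dot d m = t * dot e2 m by rewrite dE dotZl.
  have dotdd : dot d d = t ^+ 2 by rewrite tE enorm_sq.
  set p := dot e1 m in pge0; set q := dot e2 m in dotdm.
  have qge0 : 0 <= q by move: dm; rewrite dotdm pmulr_rge0.
  have xc u : dot x u = p * dot e1 u + (q + t) * dot e2 u.
    by rewrite E xE !dotDr dE !dotZr e12 (enorm1_dot e21) -/p -/q; ring.
  have yc u : dot y u = p * dot e1 u + (q - t) * dot e2 u.
    by rewrite E yE !dotDr dE !dotNr !dotZr e12 (enorm1_dot e21) -/p -/q; ring.
  have tq : t * q <= 2 * w - t ^+ 2.
    have := @john_position_dual _ 2 K (- d) x w 1 isT JK (fun u uU => (Ud u uU).2) (U1 _ Kx).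
    by rewrite mulr1 dotNl xE dotDr dotdm dotdd; lra.
  have [p0 [C [S [[p00 C0 S0] [pp0 pC tS CS1 [CS pStC]]]]]] :=
    planar_params w1 t00 fT T2 T3.
  have tt : t0 ^+ 2 < t ^+ 2 by rewrite ltr_sqr ?nnegrE ?ltW.
  have qt0 : q * t0 <= 2 * w - t0 ^+ 2.
    have : q * t0 <= q * t by rewrite ler_wpM2l// ltW.
    lra.
  pose U c sg := exists u, [/\ contact K u, c = dot e1 u & sg = dot e2 u].
  suff : t <= t0 by rewrite leNgt tt0.
  apply: (@planar_core U w t0 p0 C S p q t) => //.
  - move=> _ _ [u [[u1 _] -> ->]]; rewrite !expr2 -E; exact: enorm1_dot.
  - move=> z1 z2 w1' w2' Hz Hw.
    have lin a b u : dot (a *: e1 + b *: e2) u = a * dot e1 u + b * dot e2 u.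
      by rewrite dotDl !dotZl.
    have := @john_position_dual _ 2 K (z1 *: e1 + z2 *: e2) (w1' *: e1 + w2' *: e2) 1 1 isT JK.
    rewrite lin !dotDr !dotZr e11 e12 (dotC e2 e1) e12 (enorm1_dot e21) => H.
    have : 0 <= 2 * 1 * 1 + (z1 * (w1' * 1 + w2' * 0) + z2 * (w1' * 0 + w2' * 1)).
      by apply: H => u uU; rewrite lin; [apply: Hz|apply: Hw]; exists u.
    lra.
  - rewrite pC -(ler_pM2r t00).
    have -> : q * S * t0 = q * (t0 * S) by ring.
    rewrite tS -(ler_pM2r t00).
    have : w * (q * t0) <= w * (2 * w - t0 ^+ 2) by rewrite ler_pM2l//; lra.
    lra.
  - rewrite -(ler_pM2r t00).
    have : 0 <= (w - 7 / 5) ^+ 2 by exact: sqr_ge0.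
    lra.
  - by move=> _ _ [u [uU -> ->]]; rewrite -xc; exact: U1.
  - by move=> _ _ [u [uU -> ->]]; rewrite -yc; exact: U1.
  - move=> _ _ [u [uU _ ->]]; have [] := Ud u uU.
    rewrite dotNl dE dotZl => h1 h2.
    rewrite -[t]gtr0_norm// -normrM ler_norml; apply/andP; split; lra.
have [e1 e11 E1] := planar_frame e21.
have [p0|/ltW p0] := leP 0 (dot e1 m); first exact: (main e1).
apply: (main (- e1)); first by rewrite !dotNl dotNr opprK.
  by move=> u v; rewrite E1 !dotNl mulrNN.
by rewrite dotNl oppr_ge0.
Qed.

Lemma john_position_diam2 (K : set 'cV[R]_2) s x y :
  john_position K -> 1 <= s <= 2 -> reflects K s -> K x -> K y ->
  enorm (x - y) <= Dconst s.
Proof.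
move=> JK /andP[]; rewrite le_eqVlt => /predU1P[<- _|s1 s2] Ks Kx Ky.
  apply: le_trans (john_position_diam _ JK ltr01 Ks Kx Ky) _ => //.
  rewrite /Dconst ler_wsqrtr// expr1n subrr expr0n addr0.
  have -> : 4 * (2 - 1) ^+ 2 = 2 ^+ 2 :> R by ring.
  by rewrite sqrtr_sqr ger0_norm//; lra.
have [xy|/ltW xy] := leP 0 (dot (x + y) (x - y)).
  by apply: (john_position_diam2_aux JK _ Ks) => //; apply/andP.
rewrite enormB; apply: (john_position_diam2_aux JK _ Ks) => //; first exact/andP.
by rewrite addrC -opprB dotNr oppr_ge0.
Qed.

End Planar.

(** * Jung's theorem *)

Section Jung.
Context {R : realType}.

Lemma sum_sqr_le n (s : 'I_n -> R) : (\sum_i s i) ^+ 2 <= n%:R * \sum_i s i ^+ 2.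
Proof.
have := dot_sqr_le (\col_i s i) (const_mx 1 : 'cV[R]_n).
rewrite /dot; under eq_bigr do rewrite !mxE mulr1.
rewrite [X in _ <= X]mulrC => /le_trans; apply.
under eq_bigr do rewrite !mxE mulr1; rewrite sumr_const card_ord.
by under eq_bigr do rewrite !mxE -expr2.
Qed.

(** The weights [la] maximise the variance [V].  Moving a weight [t] to the point
    [p j] changes the variance to [(1 - t) V + t (1 - t) |p j - c| ^ 2], and to
    first order in [t] this does not exceed [V] only if [|p j - c| ^ 2 <= V].
    So [c] is the centre of the smallest ball containing the points. *)
Lemma max_variance n m (p : 'I_m.+1 -> 'cV[R]_n) :
  exists la : 'I_m.+1 -> R, exists c : 'cV[R]_n, exists V : R,
  [/\ forall i, 0 <= la i, \sum_i la i = 1, \sum_i la i *: (p i - c) = 0,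
     \sum_i la i * dot (p i - c) (p i - c) = V &
     forall j, dot (p j - c) (p j - c) <= V].
Proof.
pose De : set 'cV[R]_m.+1 := [set l | (forall i, 0 <= l i 0) /\
   (\sum_i l i 0 <= 1 /\ 1 <= \sum_i l i 0)].
pose mean (l : 'cV[R]_m.+1) : 'cV[R]_n := \sum_i l i 0 *: p i.
pose V (l : 'cV[R]_m.+1) := \sum_i l i 0 * dot (p i) (p i) - dot (mean l) (mean l).
have csum : continuous (fun l : 'cV[R]_m.+1 => \sum_i l i 0).
  by apply: sum_cts => i; exact: coord_cts.
have cmean : continuous mean.
  apply: mx_continuous => a b.
  rewrite (_ : (fun l => _) = (fun l : 'cV[R]_m.+1 => \sum_i l i 0 * p i a b)); last first.
    by apply/funext => l; rewrite summxE; apply: eq_bigr => i _; rewrite mxE.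
  by apply: sum_cts => i; apply: mul_cts; [exact: coord_cts|exact: cst_cts].
have cV : continuous V.
  apply: add_cts; last by apply: opp_cts; exact: dot_cts.
  by apply: sum_cts => i; apply: mul_cts; [exact: coord_cts|exact: cst_cts].
have cDe : compact De.
  apply: (@mx_bounded_compact _ _ _ 1).
    apply: closed_setAnd.
      rewrite (_ : mkset _ = [set l : 'cV[R]_m.+1 | forall i, setT i -> 0 <= l i 0]); last first.
        by apply/seteqP; split=> l /= H i; move=> *; exact: H.
      apply: (@closed_forall _ _ (fun i (l : 'cV[R]_m.+1) => 0 <= l i 0)) => i _.
      by apply: closed_cts_le; [exact: cst_cts|exact: coord_cts].
    by apply: closed_setAnd; apply: closed_cts_le => //; exact: cst_cts.
  move=> l [l0 [l1 _]] i j; rewrite ord1 ger0_norm//; apply: le_trans l1.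
  by rewrite (bigD1 i)//= lerDl sumr_ge0.
have D0 : De !=set0.
  exists (delta_mx 0 0); split; first by move=> i; rewrite mxE ler0n.
  rewrite (bigD1 0)//= big1 ?addr0; first by rewrite mxE !eqxx lexx.
  by move=> i i0; rewrite mxE (negbTE i0).
have [la [la0 [la1 la1']] lmax] := compact_argmin D0 cDe (opp_cts cV).
have {la1' la1} las : \sum_i la i 0 = 1 by apply/eqP; rewrite eq_le la1 la1'.
pose c := mean la.
have VE : \sum_i la i 0 * dot (p i - c) (p i - c) = V la.
  transitivity (\sum_i (la i 0 * dot (p i) (p i) - 2 * (dot (la i 0 *: p i) c) + la i 0 * dot c c)).
    by apply: eq_bigr => i _; rewrite !dotE (dotC c (p i)); ring.
  rewrite !big_split /= -mulr_suml las sumrN -mulr_sumr -dot_suml -/(mean la) -/c.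
  by rewrite /V -/c; ring.
exists (fun i => la i 0), c, (V la); split => //.
  under eq_bigr do rewrite scalerBr.
  by rewrite sumrB -scaler_suml las scale1r subrr.
move=> j; rewrite -subr_le0; apply: (@le0_of_le_small _ _ (dot (p j - c) (p j - c))) => t t01.
have [t0 t1] := andP t01.
pose lt := (1 - t) *: la + t *: delta_mx j 0 : 'cV[R]_m.+1.
have ltE i : lt i 0 = (1 - t) * la i 0 + t * (i == j)%:R by rewrite !mxE eqxx andbT.
have sumlt (f : 'I_m.+1 -> R) :
    \sum_i lt i 0 * f i = (1 - t) * \sum_i la i 0 * f i + t * f j.
  under eq_bigr do rewrite ltE mulrDl -mulrA; rewrite big_split /= -mulr_sumr; congr (_ + _).
  rewrite (bigD1 j)//= big1 ?addr0; first by rewrite eqxx mulr1.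
  by move=> i ij; rewrite (negbTE ij) mulr0 mul0r.
have Dlt : De lt.
  split; first by move=> i; rewrite ltE addr_ge0// mulr_ge0 ?(ltW t0) ?subr_ge0.
  have -> : \sum_i lt i 0 = 1.
    transitivity (\sum_i lt i 0 * 1); first by apply: eq_bigr => i _; rewrite mulr1.
    by rewrite (sumlt (fun=> 1)) mulr1 -mulr_suml las; ring.
  by rewrite lexx.
have mlt : mean lt = (1 - t) *: c + t *: p j.
  apply/matrixP => a b; rewrite !mxE /mean !summxE.
  under eq_bigr do rewrite mxE.
  rewrite (sumlt (fun i => p i a b)); congr (_ * _ + _).
  by apply: eq_bigr => i _; rewrite mxE.
have := lmax _ Dlt; rewrite lerN2.
have -> : V lt = (1 - t) * V la + t * (1 - t) * dot (p j - c) (p j - c).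
  rewrite {1}/V mlt (sumlt (fun i => dot (p i) (p i))) /V -/c !dotE (dotC c (p j)); ring.
have -> : (1 - t) * V la + t * (1 - t) * dot (p j - c) (p j - c) =
  V la + t * ((1 - t) * dot (p j - c) (p j - c) - V la) by ring.
by rewrite gerDl pmulr_rle0//; lra.
Qed.

(** Let [q i = p i - c] and [g = D ^ 2 / 2 - V].  For points of positive weight
    [|q i| ^ 2 = V], hence [- g <= <q i, q k> <= V], and averaging
    [(<q i, q k> + g) (V - <q i, q k>) >= 0] bounds the trace [T2] of the square
    of the covariance matrix by [g V].  Its trace is [V], so that
    [V ^ 2 <= n T2 <= n g V].  Thus the factor [n / (n + 1)] comes out without
    reducing to [n + 1] points. *)
Lemma jung_finite n m (p : 'I_m.+1 -> 'cV[R]_n) (D : R) :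
  (forall i j, enorm (p i - p j) <= D) ->
  exists c, forall j, 2 * (n%:R + 1) * dot (p j - c) (p j - c) <= n%:R * D ^+ 2.
Proof.
move=> pD; have [la [c [V [la0 la1 lac laV Vmax]]]] := max_variance p.
exists c => j; have D0 : 0 <= D by apply: le_trans (pD 0 0); exact: enorm_ge0.
have nR : 0 <= n%:R :> R by [].
suff VD : 2 * (n%:R + 1) * V <= n%:R * D ^+ 2.
  by apply: le_trans VD; rewrite ler_wpM2l//; lra.
have [q qE] : exists q : 'I_m.+1 -> 'cV[R]_n, forall i, p i - c = q i
  by exists (fun i => p i - c).
move: lac laV; under eq_bigr do rewrite qE; move=> lac.
under eq_bigr do rewrite qE; move=> laV.
have qV i : 0 < la i -> dot (q i) (q i) = V.
  move=> lai; have : \sum_i la i * (V - dot (q i) (q i)) = 0.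
    under eq_bigr do rewrite mulrBr; rewrite sumrB -mulr_suml la1 mul1r laV.
    by rewrite subrr.
  have nn (k : 'I_m.+1) : true -> 0 <= la k * (V - dot (q k) (q k)).
    by move=> _; rewrite mulr_ge0// subr_ge0 -qE; exact: Vmax.
  move=> /(psumr_eq0P nn)/(_ i isT)/eqP.
  by rewrite mulf_eq0 gt_eqF//= subr_eq0 => /eqP.
have V0 : 0 <= V by apply: le_trans (dot_ge0 _) (Vmax 0).
pose g := D ^+ 2 / 2 - V.
pose t i k := dot (q i) (q k).
have pair i k : 0 <= la i * la k * ((t i k + g) * (V - t i k)).
  have := la0 i; rewrite le_eqVlt => /predU1P[<-|li]; first by rewrite !mul0r.
  have := la0 k; rewrite le_eqVlt => /predU1P[<-|lk]; first by rewrite mulr0 mul0r.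
  have := pD i k; rewrite enorm_le//.
  have -> : p i - p k = q i - q k by rewrite -!qE opprB addrA subrK.
  have -> : dot (q i - q k) (q i - q k) = 2 * V - 2 * t i k.
    rewrite !dotDl !dotDr !dotNl !dotNr (qV _ li) (qV _ lk) (dotC (q k)) /t; ring.
  move=> h1; have h2 := dot_ge0 (q i - q k).
  rewrite !dotDl !dotDr !dotNl !dotNr (qV _ li) (qV _ lk) (dotC (q k)) -/(t i k) in h2.
  by rewrite !mulr_ge0 ?(ltW li) ?(ltW lk)// /g; lra.
pose T2 := \sum_i \sum_k la i * la k * t i k ^+ 2.
have T2le : T2 <= g * V.
  have : 0 <= \sum_i \sum_k la i * la k * ((t i k + g) * (V - t i k)).
    by apply: sumr_ge0 => i _; apply: sumr_ge0 => k _.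
  have s1 : \sum_i \sum_k la i * la k = 1.
    under eq_bigr do rewrite -mulr_sumr la1 mulr1; exact: la1.
  have s2 : \sum_i \sum_k la i * la k * t i k = 0.
    transitivity (dot (\sum_i la i *: q i) (\sum_i la i *: q i)); last by rewrite lac dot0l.
    rewrite dot_suml.
    apply: eq_bigr => i _; rewrite dot_sumr; apply: eq_bigr => k _.
    by rewrite dotZl dotZr mulrA.
  have -> : \sum_i \sum_k la i * la k * ((t i k + g) * (V - t i k)) =
     (g * V) * (\sum_i \sum_k la i * la k) + (V - g) * (\sum_i \sum_k la i * la k * t i k) - T2.
    rewrite /T2 !mulr_sumr -big_split -sumrB; apply: eq_bigr => i _ /=.
    rewrite !mulr_sumr -big_split -sumrB; apply: eq_bigr => k _ /=; ring.
  by rewrite s1 s2 mulr1 mulr0 addr0 subr_ge0.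
pose S a b := \sum_i la i * (q i a 0 * q i b 0).
have T2E : T2 = \sum_a \sum_b S a b ^+ 2.
  rewrite /T2.
  transitivity (\sum_i \sum_k \sum_a \sum_b
     (la i * (q i a 0 * q i b 0)) * (la k * (q k a 0 * q k b 0))).
    apply: eq_bigr => i _; apply: eq_bigr => k _.
    rewrite expr2 /t /dot mulr_suml mulr_sumr; apply: eq_bigr => a _.
    rewrite !mulr_sumr; apply: eq_bigr => b _; ring.
  under eq_bigr do rewrite exchange_big; rewrite exchange_big; apply: eq_bigr => a _ /=.
  under eq_bigr do rewrite exchange_big; rewrite exchange_big; apply: eq_bigr => b _ /=.
  by rewrite expr2 /S mulr_suml; apply: eq_bigr => i _; rewrite mulr_sumr.
have trS : \sum_a S a a = V.
  rewrite -laV /S exchange_big /=; apply: eq_bigr => i _.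
  by rewrite -mulr_sumr.
have V2 : V ^+ 2 <= n%:R * (g * V).
  rewrite -trS; apply: le_trans (sum_sqr_le _) _; rewrite trS ler_wpM2l//.
  apply: le_trans T2le; rewrite T2E; apply: ler_sum => a _.
  by rewrite (bigD1 a)//= lerDl sumr_ge0// => b _; exact: sqr_ge0.
have [V00|V00] := eqVneq V 0; first by rewrite V00 mulr0 mulr_ge0// sqr_ge0.
have Vp : 0 < V by rewrite lt_def V00 V0.
have : V <= n%:R * g by rewrite -(ler_pM2r Vp) -expr2 -mulrA.
rewrite /g; lra.
Qed.

(** Approximation by a finite [e]-net. *)
Lemma jung n (K : set 'cV[R]_n) (D e : R) : compact K -> 0 < e ->
  (forall x y, K x -> K y -> enorm (x - y) <= D) ->
  exists c, K `<=` eball c (D * Num.sqrt (n%:R / (2 * (n%:R + 1))) + e).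
Proof.
move=> cK e0 KD.
have [K0|K0] := pselect (K !=set0); last by exists 0 => x Kx; exfalso; apply: K0; exists x.
have [x0 Kx0] := K0.
have D0 : 0 <= D by apply: le_trans (KD _ _ Kx0 Kx0); exact: enorm_ge0.
pose f (x : 'cV[R]_n) := [set y : 'cV[R]_n | enorm (y - x) < e].
have fop x : open (f x).
  rewrite (_ : f x = (fun y => enorm (y - x)) @^-1` [set r | r < e])//.
  apply: open_comp; last exact: open_lt.
  by move=> y _; apply: enorm_cts; apply: mxB_cts; [exact: id_cts|exact: cst_cts].
have := cK; rewrite compact_cover => /(_ 'cV[R]_n K f (fun x _ => fop x)).
have Kcov : K `<=` cover K f by move=> x Kx; exists x => //=; rewrite /f /= subrr enorm0.
move=> /(_ Kcov)[D' D'K Dcov].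
have szD : (0 < size (enum_fset D'))%N.
  have [i iD _] := Dcov _ Kx0.
  have : i \in enum_fset D' by exact: iD.
  by case: (enum_fset D').
pose m := (size (enum_fset D')).-1; pose p (i : 'I_m.+1) := nth 0 (enum_fset D') i.
have pK i : K (p i).
  have : p i \in enum_fset D' by rewrite mem_nth// -[X in (_ < X)%N](prednK szD) ltn_ord.
  by move=> /D'K; rewrite inE.
have [c Hc] := jung_finite (fun i j => KD _ _ (pK i) (pK j)).
exists c => x Kx; rewrite eballE.
have [y /= yD xy] := Dcov _ Kx.
have yi : (index y (enum_fset D') < m.+1)%N by rewrite (prednK szD) index_mem.
have yE : y = p (Ordinal yi) by rewrite /p /= nth_index.
have -> : x - c = (x - y) + (y - c) by rewrite addrA subrK.
apply: le_trans (enormD _ _) _; rewrite addrC lerD//; last exact: ltW.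
have n1 : 0 < 2 * (n%:R + 1) :> R by rewrite mulr_gt0// ltr_wpDl.
rewrite enorm_le; last by rewrite mulr_ge0// sqrtr_ge0.
rewrite exprMn sqr_sqrtr; last by rewrite divr_ge0// ltW.
by rewrite mulrA ler_pdivlMr// [X in X <= _]mulrC [X in _ <= X]mulrC yE; exact: Hc.
Qed.

End Jung.

(** * Diameter and inradius *)

Section Functionals.
Context {R : realType} {n : nat}.
Implicit Types (K S : set 'cV[R]_n) (A : 'M[R]_n).

Lemma diameter_ub S x y : compact S -> S x -> S y -> enorm (x - y) <= diameter S.
Proof.
move=> cS Sx Sy; have [M M0 SM] := compact_enorm_bound cS.
apply: ub_le_sup; last by exists x, y.
exists (M + M) => _ [a [b [Sa Sb ->]]].
by apply: le_trans (enormD _ _) _; rewrite enormN lerD// SM.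
Qed.

Lemma diameter_le S D : S !=set0 ->
  (forall x y, S x -> S y -> enorm (x - y) <= D) -> diameter S <= D.
Proof.
move=> [x Sx] SD; apply: ge_sup; first by exists (enorm (x - x)), x, x.
by move=> _ [a [b [Sa Sb ->]]]; exact: SD.
Qed.

Lemma lin_image_compact K A : compact K -> compact (lin_image A K).
Proof.
move=> cK; apply: continuous_compact => //; apply: continuous_subspaceT.
by apply: mulmx_cts; [exact: cst_cts|exact: id_cts].
Qed.

Lemma lin_imageE K A x : A \in unitmx -> lin_image A K x <-> K (invmx A *m x).
Proof.
move=> uA; split=> [[y Ky <-]|Kx]; first by rewrite mulKmx.
by exists (invmx A *m x) => //; rewrite mulKVmx.
Qed.

Context (n0 : (0 < n)%N).

Let axis : 'cV[R]_n := delta_mx (Ordinal n0) 0.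

Lemma enorm_axis : enorm axis = 1.
Proof.
rewrite enormE /dot (bigD1 (Ordinal n0))//= big1 ?addr0.
  by rewrite !mxE !eqxx mulr1 sqrtr1.
by move=> i i0; rewrite mxE (negbTE i0) mul0r.
Qed.

Lemma ball_diameter S c r : compact S -> 0 <= r -> eball c r `<=` S ->
  2 * r <= diameter S.
Proof.
move=> cS r0 rS.
have Sp : S (c + r *: axis).
  by apply: rS; rewrite eballE addrAC subrr add0r enormZ enorm_axis mulr1 ger0_norm.
have Sm : S (c - r *: axis).
  by apply: rS; rewrite eballE addrAC subrr add0r enormN enormZ enorm_axis mulr1 ger0_norm.
have := diameter_ub cS Sp Sm.
have -> : c + r *: axis - (c - r *: axis) = (2 * r) *: axis.
  by apply/matrixP => i j; rewrite !mxE; ring.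
by rewrite enormZ enorm_axis mulr1 ger0_norm// mulr_ge0.
Qed.

Lemma inradius_ub S c r : compact S -> 0 <= r -> eball c r `<=` S -> r <= inradius S.
Proof.
move=> cS r0 rS; apply: ub_le_sup; last by split=> //; exists c.
exists (diameter S / 2) => x [x0 [b bS]].
by rewrite ler_pdivlMr// mulrC; exact: ball_diameter bS.
Qed.

Lemma inradius_le S r0 : S !=set0 ->
  (forall r c, 0 <= r -> eball c r `<=` S -> r <= r0) -> inradius S <= r0.
Proof.
move=> [x Sx] H; apply: ge_sup.
  exists 0; split=> //; exists x => y; rewrite eballE => yx.
  have : enorm (y - x) == 0 by rewrite eq_le yx enorm_ge0.
  by rewrite enorm_eq0 subr_eq0 => /eqP ->.
by move=> r [r1 [c rS]]; exact: H rS.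
Qed.

Lemma mulmx_bound (B : 'M[R]_n) :
  exists M : R, 0 < M /\ forall x : 'cV[R]_n, enorm (B *m x) <= M * enorm x.
Proof.
pose M := 1 + \sum_i enorm (row i B)^T.
have s0 : 0 <= \sum_i enorm (row i B)^T by apply: sumr_ge0 => i _; exact: enorm_ge0.
exists M; split=> [|x]; first by rewrite /M; lra.
apply: le_trans (enorm_le_sum _) _.
apply: (@le_trans _ _ ((\sum_i enorm (row i B)^T) * enorm x)); last first.
  by rewrite ler_wpM2r ?enorm_ge0// /M; lra.
rewrite mulr_suml; apply: ler_sum => i _.
have -> : (B *m x) i 0 = dot (row i B)^T x.
  by rewrite mxE; apply: eq_bigr => j _; rewrite !mxE.
exact: dot_abs_le.
Qed.

Lemma lin_image_ball K A : A \in unitmx -> convex_body K ->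
  exists2 r, 0 < r & exists c, eball c r `<=` lin_image A K.
Proof.
move=> uA [cK vK [c /interior_eball[r r0 rK]]].
have [M [M0 HM]] : exists M : R, 0 < M /\ forall x, enorm (invmx A *m x) <= M * enorm x.
  exact: mulmx_bound.
exists (r / M); first by rewrite divr_gt0.
exists (A *m c) => x; rewrite eballE => xc; apply/lin_imageE => //; apply: rK.
rewrite eballE -[c](mulKmx uA) -mulmxBr.
by apply: le_trans (HM _) _; rewrite -ler_pdivlMl// mulrC.
Qed.

(** * Lower bounds through the Minkowski asymmetry *)

Definition mink_feasible K rho := 0 <= rho /\
    exists t, [set - x + t | x in K] `<=` [set rho *: x | x in K].

Lemma mink_le K rho : mink_feasible K rho -> minkowski_asymmetry K <= rho.
Proof. by move=> H; apply: ge_inf H; exists 0 => x []. Qed.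

(** The inclusions [- A K `<=` - c' + r' B] and [r B `<=` A K - c], where [B] is the
    unit ball, compose. *)
Lemma mink_enclosed K A c r c' r' : A \in unitmx -> K !=set0 -> 0 < r ->
  eball c r `<=` lin_image A K -> lin_image A K `<=` eball c' r' ->
  mink_feasible K (r' / r).
Proof.
move=> uA [x Kx] r0 rK Kr'.
have r'0 : 0 <= r'.
  by have := Kr' (A *m x); rewrite eballE => H; apply: le_trans (enorm_ge0 _) (H _); exists x.
split; first by rewrite divr_ge0// ltW.
exists (invmx A *m (c' + (r' / r) *: c)) => _ [z Kz <-] /=.
have [r00|r00] := eqVneq r' 0.
  have zE (v : 'cV[R]_n) : lin_image A K v -> v = c'.
    move=> /Kr'; rewrite eballE r00 => vc; apply/eqP; rewrite -subr_eq0 -enorm_eq0.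
    by rewrite eq_le vc enorm_ge0.
  exists z => //; rewrite r00 mul0r !scale0r addr0.
  have -> : c' = A *m z by rewrite -(zE (A *m z))//; exists z.
  by rewrite mulKmx// addNr.
have rp : r' / r != 0 by rewrite mulf_neq0// invr_eq0 gt_eqF.
exists ((r' / r)^-1 *: (- z + invmx A *m (c' + (r' / r) *: c))); last first.
  by rewrite scalerA mulfV// scale1r.
have : lin_image A K (c - (r' / r)^-1 *: (A *m z - c')).
  apply: rK; rewrite eballE addrAC subrr add0r enormN enormZ gtr0_norm; last first.
    by rewrite invr_gt0 divr_gt0// lt_def r00.
  have : enorm (A *m z - c') <= r' by apply: Kr'; exists z.
  rewrite invf_div => h; apply: le_trans (ler_wpM2l _ h) _; first by rewrite divr_ge0// ltW.
  by rewrite divfK.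
move=> /lin_imageE/wrap[//|]; rewrite -/(is_true _).
set X := _ *m _; set Y := _ *: (_ + _); suff -> : X = Y by [].
rewrite /X /Y mulmxBr -scalemxAr mulmxBr mulKmx// mulmxDr -scalemxAr.
by move: (invmx A *m c) (invmx A *m c') => a b; apply/matrixP => i j; rewrite !mxE; field;
  rewrite ?r00 ?gt_eqF.
Qed.

Lemma lin_image1 K : lin_image 1%:M K = K.
Proof.
apply/seteqP; split=> x; first by case=> y Ky <-; rewrite mul1mx.
by move=> Kx; exists x; rewrite ?mul1mx.
Qed.

Lemma mink_feasible_ex K : convex_body K -> exists rho, mink_feasible K rho.
Proof.
move=> bK; have [cK _ _] := bK; have u1 := @unitmx1 R n.
have [r r0 [c rK]] := lin_image_ball u1 bK.
have [M M0 KM] := compact_enorm_bound cK.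
have Kc : K c by rewrite -(lin_image1 K); apply: rK; rewrite eballE subrr enorm0 ltW.
exists (M / r); apply: (mink_enclosed u1 _ r0 rK (c' := 0)); first by exists c.
by move=> x; rewrite lin_image1 => /KM; rewrite eball0E.
Qed.

Lemma body_diameter_gt0 K : convex_body K -> 0 < diameter K.
Proof.
move=> [cK _ [c /interior_eball[r r0 rK]]].
by apply: lt_le_trans (ball_diameter cK (ltW r0) rK); rewrite mulr_gt0.
Qed.

Lemma body_nonempty K : convex_body K -> K !=set0.
Proof. by move=> [_ _ [c /interior_subset Kc]]; exists c. Qed.

(** The inclusion of a translate of [- K] in [rho K] compares their diameters. *)
Lemma mink_feasible_ge1 K rho : convex_body K -> mink_feasible K rho -> 1 <= rho.
Proof.
move=> bK [rho0 [t Ht]]; have [cK _ _] := bK; have D0 := body_diameter_gt0 bK.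
rewrite -(ler_pM2r D0) mul1r; apply: diameter_le; first exact: body_nonempty.
move=> x y Kx Ky.
have [a Ka aE] : [set rho *: x | x in K] (- x + t) by apply: Ht; exists x.
have [b Kb bE] : [set rho *: x | x in K] (- y + t) by apply: Ht; exists y.
have -> : x - y = rho *: (b - a).
  by rewrite scalerBr aE bE opprD opprK addrACA subrr addr0 addrC.
by rewrite enormZ ger0_norm// ler_wpM2l//; exact: diameter_ub.
Qed.

Lemma mink_ge1 K : convex_body K -> 1 <= minkowski_asymmetry K.
Proof.
move=> bK; apply: lb_le_inf; first exact: mink_feasible_ex.
by move=> rho; exact: mink_feasible_ge1.
Qed.

(** A feasible [rho] puts [A K] in a ball of radius
    [diameter * rho / (rho + 1)]: with [- x + t = rho z], the difference of the
    points [x] and [z] of [K] is [(1 + 1 / rho) x - t / rho]. *)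
Lemma mink_diameter K A c r rho : convex_body K -> A \in unitmx -> 0 < r ->
  eball c r `<=` lin_image A K -> mink_feasible K rho ->
  minkowski_asymmetry K * (rho + 1) * r <= diameter (lin_image A K) * rho.
Proof.
move=> bK uA r0 rK Frho; have rho1 := mink_feasible_ge1 bK Frho.
have [rho0 [t Ht]] := Frho; have [cK _ _] := bK.
have cS : compact (lin_image A K) by exact: lin_image_compact.
set D := diameter _.
have rp : 0 < rho + 1 by lra.
have sub : lin_image A K `<=` eball ((rho + 1)^-1 *: (A *m t)) (D * rho / (rho + 1)).
  move=> _ [x Kx <-]; rewrite eballE.
  have [z Kz zE] : [set rho *: x | x in K] (- x + t) by apply: Ht; exists x.
  have -> : A *m x - (rho + 1)^-1 *: (A *m t) = (rho / (rho + 1)) *: (A *m x - A *m z).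
    have -> : t = x + rho *: z by rewrite zE addrA subrr add0r.
    rewrite mulmxDr -scalemxAr; apply/matrixP => i j; rewrite !mxE; field.
    by rewrite gt_eqF.
  rewrite enormZ ger0_norm; last by rewrite divr_ge0// ltW.
  rewrite -mulrA mulrC ler_wpM2r ?divr_ge0 ?(ltW rp)//.
  by apply: diameter_ub => //; [exists x|exists z].
have := mink_le (mink_enclosed uA (body_nonempty bK) r0 rK sub).
by rewrite ler_pdivlMr// ler_pdivlMr// mulrAC.
Qed.

Lemma lower_bound_ge1 K : convex_body K -> 1 <= lower_bound n (minkowski_asymmetry K).
Proof.
move=> bK; have := mink_ge1 bK => s1.
by rewrite /lower_bound le_max; apply/orP; right; lra.
Qed.

(** The first term of the lower bound comes from Jung's theorem, the second one
    from [mink_diameter]; both estimate the radius of an enclosing ball. *)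
Lemma ball_lower_bound K A c r : convex_body K -> A \in unitmx -> 0 < r ->
  eball c r `<=` lin_image A K ->
  2 * r * lower_bound n (minkowski_asymmetry K) <= diameter (lin_image A K).
Proof.
move=> bK uA r0 rK; have [cK _ _] := bK; have cS : compact (lin_image A K)
  by exact: lin_image_compact.
set D := diameter _; set s := minkowski_asymmetry K.
have D0 : 0 <= D by apply: le_trans (ball_diameter cS (ltW r0) rK); rewrite mulr_ge0// ltW.
have s1 : 1 <= s by exact: mink_ge1.
have nR : 0 < n%:R :> R by rewrite ltr0n.
rewrite /lower_bound maxr_pMr; last by rewrite mulr_ge0// ltW.
rewrite ge_max; apply/andP; split.
  set k := Num.sqrt _; pose k' := Num.sqrt (n%:R / (2 * (n%:R + 1))) : R.
  have kk : k * k' = 2^-1.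
    rewrite /k /k' -sqrtrM; last by rewrite divr_ge0 ?addr_ge0 ?mulr_ge0// ltW.
    have -> : (n%:R + 1) / (2 * n%:R) * (n%:R / (2 * (n%:R + 1))) = 2^-1 ^+ 2 :> R.
      by field; rewrite !gt_eqF// addr_gt0.
    by rewrite sqrtr_sqr ger0_norm// invr_ge0.
  have h : s * r <= D * k'.
    apply/ler_addgt0Pr => e e0.
    have [c' Hc'] := @jung R n (lin_image A K) D e cS e0 (fun x y Sx Sy => diameter_ub cS Sx Sy).
    have := mink_le (mink_enclosed uA (body_nonempty bK) r0 rK Hc').
    by rewrite ler_pdivlMr.
  have -> : 2 * r * (s * k) = 2 * k * (s * r) by ring.
  have k0 : 0 <= k by exact: sqrtr_ge0.
  apply: le_trans (ler_wpM2l _ h) _; first by rewrite mulr_ge0.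
  by have -> : 2 * k * (D * k') = 2 * D * (k * k') by [ring]; rewrite kk; lra.
suff : (s + 1) * r <= D by lra.
have sr0 : 0 < s * r by rewrite mulr_gt0//; lra.
suff : s * (s + 1) * r <= D * s by rewrite -mulrA mulrC ler_pM2r//; lra.
apply/ler_addgt0Pr => e e0.
have D1 : 0 < D + 1 by lra.
have [rho Frho rhos] : exists2 rho, mink_feasible K rho & rho < s + e / (D + 1).
  apply: inf_adherent; first by rewrite divr_gt0.
  split; first exact: mink_feasible_ex.
  by exists 0 => x [].
have srho : s <= rho by exact: mink_le.
have := mink_diameter bK uA r0 rK Frho; rewrite -/D -/s => h.
have h1 : s * (s + 1) * r <= s * (rho + 1) * r.
  by rewrite ler_pM2r// ler_wpM2l//; lra.
have h2 : D * rho <= D * (s + e / (D + 1)) by rewrite ler_wpM2l// ltW.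
have h3 : D * (e / (D + 1)) <= e.
  by rewrite mulrCA ler_piMr ?(ltW e0)// ler_pdivrMr// mul1r; lra.
lra.
Qed.

Lemma inradius_gt0 K A : convex_body K -> A \in unitmx -> 0 < inradius (lin_image A K).
Proof.
move=> bK uA; have [cK _ _] := bK.
have [r r0 [c rK]] := lin_image_ball uA bK.
exact: lt_le_trans (inradius_ub (lin_image_compact cK) (ltW r0) rK).
Qed.

Lemma lin_image_nonempty K A : K !=set0 -> lin_image A K !=set0.
Proof. by move=> [x Kx]; exists (A *m x); exists x. Qed.

Lemma inradius_mul_le S a D : S !=set0 -> 0 < a -> 0 <= D ->
  (forall r c, 0 < r -> eball c r `<=` S -> a * r <= D) -> a * inradius S <= D.
Proof.
move=> S0 a0 D0 H; rewrite -ler_pdivlMl//; apply: inradius_le => // r c.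
rewrite le_eqVlt => /predU1P[<- _|r0 rS]; first by rewrite mulr_ge0// invr_ge0 ltW.
by rewrite ler_pdivlMl//; exact: H rS.
Qed.

Lemma diameter_ge0 S : compact S -> S !=set0 -> 0 <= diameter S.
Proof.
by move=> cS [x Sx]; apply: le_trans (enorm_ge0 _) (diameter_ub cS Sx Sx).
Qed.

Lemma ratio_ge_lower_bound K : convex_body K ->
  lbound (diam_inradius_ratios K) (lower_bound n (minkowski_asymmetry K)).
Proof.
move=> bK _ [A uA <-]; have [cK _ _] := bK.
have cS : compact (lin_image A K) by exact: lin_image_compact.
have S0 := lin_image_nonempty A (body_nonempty bK).
have r0 := inradius_gt0 bK uA; have L1 := lower_bound_ge1 bK.
set L := lower_bound _ _ in L1 *.
rewrite ler_pdivlMr ?mulr_gt0//.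
have -> : L * (2 * inradius (lin_image A K)) = (2 * L) * inradius (lin_image A K) by ring.
apply: inradius_mul_le => //; [lra|exact: diameter_ge0|move=> r c rp rS].
by have := ball_lower_bound bK uA rp rS; rewrite -/L; lra.
Qed.

(** * The optimal linear image *)

Lemma ratio_le K A c D : convex_body K -> A \in unitmx ->
  eball c 1 `<=` lin_image A K ->
  (forall x y, K x -> K y -> enorm (A *m (x - y)) <= D) ->
  diameter (lin_image A K) / (2 * inradius (lin_image A K)) <= D / 2.
Proof.
move=> bK uA BS KD; have [cK _ _] := bK.
have cS : compact (lin_image A K) by exact: lin_image_compact.
have S0 := lin_image_nonempty A (body_nonempty bK).
have r0 := inradius_gt0 bK uA.
have r1 : 1 <= inradius (lin_image A K) by exact: inradius_ub BS.
have dD : diameter (lin_image A K) <= D.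
  by apply: diameter_le => // _ _ [x Kx <-] [y Ky <-]; rewrite -mulmxBr; exact: KD.
have d0 := diameter_ge0 cS S0.
rewrite ler_pdivrMr ?mulr_gt0//.
have : D * 1 <= D * inradius (lin_image A K) by rewrite ler_wpM2l//; lra.
lra.
Qed.

(** Normalising the inradius to one, the competitors are the matrices [A] with a
    unit ball inside [A K].  Recording the inverse [B], the centre of the ball
    seen in [K] and a bound [M] on the diameter makes all the constraints closed
    and bounded, so that [M] can be minimised by compactness.  The bound [M0]
    is the diameter of [r0^-1 K], where [K] contains a ball of radius [r0]. *)
Lemma ratio_min_exists K : convex_body K ->
  exists m, is_minimum (diam_inradius_ratios K) m.
Proof.
move=> bK; have [cK vK [c0 /interior_eball[r0 r00 rK0]]] := bK.
have [N N0 KN] := compact_enorm_bound cK.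
pose M0 := diameter K / r0.
have d0 := body_diameter_gt0 bK.
have M00 : 0 < M0 by rewrite divr_gt0.
pose T := (('cV[R]_n * 'M[R]_n) * ('M[R]_n * R))%type.
pose X : set T := [set X | ellipsoid X.1.1 X.1.2 `<=` K /\
  (X.2.1 *m X.1.2 = 1%:M /\
  ((forall x, K x -> forall y, K y -> enorm (X.2.1 *m (x - y)) <= X.2.2) /\
   (0 <= X.2.2 /\ X.2.2 <= M0)))].
have c11 : continuous (fun X : T => X.1.1).
  by apply: comp_cts; exact: fst_cts.
have c12 : continuous (fun X : T => X.1.2).
  by apply: comp_cts; [exact: snd_cts|exact: fst_cts].
have c21 : continuous (fun X : T => X.2.1).
  by apply: comp_cts; [exact: fst_cts|exact: snd_cts].
have c22 : continuous (fun X : T => X.2.2).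
  by apply: comp_cts; exact: snd_cts.
have clX : closed X.
  apply: closed_setAnd; last apply: closed_setAnd; last apply: closed_setAnd;
    last apply: closed_setAnd.
  - exact: (closed_ellipsoid_in (cV_compact_closed cK) c11 c12).
  - apply: (closed_cts (f := fun X : T => X.2.1 *m X.1.2) (S := [set 1%:M])).
      exact: (mulmx_cts c21 c12).
    by apply: cV_compact_closed; exact: compact_set1.
  - apply: (@closed_forall _ _ (fun x (X : T) => forall y, K y -> enorm (X.2.1 *m (x - y)) <= X.2.2) K) => x _.
    apply: (@closed_forall _ _ (fun y (X : T) => enorm (X.2.1 *m (x - y)) <= X.2.2) K) => y _.
    apply: closed_cts_le => //; apply: enorm_cts; apply: mulmx_cts => //; exact: cst_cts.
  - by apply: closed_cts_le => //; exact: cst_cts.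
  - by apply: closed_cts_le => //; exact: cst_cts.
have cX : compact X.
  pose Bx (m k : nat) b : set 'M[R]_(m, k) := [set A | forall i j, `|A i j| <= b].
  pose Y : set T := (Bx n 1%N N `*` Bx n n (2 * N)) `*` (Bx n n (M0 / r0) `*` `[0, M0]%classic).
  have cY : compact Y.
    by do ?apply: compact_setX; try exact: mx_entries_compact; exact: segment_compact.
  apply: (subclosed_compact clX cY).
  move=> [[c B] [A M]] /= [BK [AB [AM [M1 M2]]]].
  split; split=> /=.
  - move=> i j; rewrite ord1 (le_trans (enorm_coord _ _))// KN//.
    exact: ellipsoid_center_in BK.
  - by move=> i j; exact: (ellipsoid_entries BK KN).
  - move=> i j; pose e : 'cV[R]_n := delta_mx j 0.
    have Ke : K (c0 + r0 *: e).
      apply: rK0; rewrite eballE addrAC subrr add0r enormZ gtr0_norm//.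
      by rewrite ler_piMr ?(ltW r00)//; have := @delta_eball R n j; rewrite eball0E.
    have Kc : K c0 by apply: rK0; rewrite eballE subrr enorm0 ltW.
    have := AM _ Ke _ Kc; rewrite addrAC subrr add0r -scalemxAr enormZ gtr0_norm// => h.
    have -> : A i j = (A *m e) i 0.
      rewrite mxE (bigD1 j)//= big1 ?addr0; first by rewrite mxE !eqxx mulr1.
      by move=> k kj; rewrite mxE (negbTE kj) mulr0.
    apply: le_trans (enorm_coord _ _) _.
    by rewrite ler_pdivlMr// mulrC; lra.
  - by rewrite in_itv/= M1 M2.
have X0 : X ((c0, r0%:M), (r0^-1%:M, M0)).
  split=> /=; last split; last split.
  - move=> _ [x + <-]; rewrite eball0E => x1; apply: rK0.
    rewrite eballE addrAC subrr add0r mul_scalar_mx enormZ gtr0_norm//.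
    by rewrite ler_piMr// ltW.
  - by rewrite -scalar_mxM mulVf// gt_eqF.
  - move=> x Kx y Ky; rewrite mul_scalar_mx enormZ gtr0_norm ?invr_gt0// mulrC.
    by rewrite ler_pM2r ?invr_gt0//; exact: diameter_ub.
  - by rewrite (ltW M00) lexx.
have [[[c B] [A M]] /= [BK [AB [AM [M1 M2]]]] Mmin] := compact_argmin (ex_intro _ _ X0) cX c22.
have [uA uB] := mulmx1_unit AB.
have Minv : invmx A = B by rewrite -[LHS]mulmx1 -AB mulKmx.
pose m := diameter (lin_image A K) / (2 * inradius (lin_image A K)).
have mM : m <= M / 2.
  apply: (@ratio_le K A (A *m c)) => //; last by move=> x y Kx Ky; exact: AM.
  move=> x; rewrite eballE => xc; apply/lin_imageE => //.
  apply: BK; exists (x - A *m c); first by rewrite eball0E.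
  by rewrite mulmxBr -Minv mulKmx// addrC subrK.
exists m; split; first by exists A.
move=> _ [A' uA' <-]; apply: le_trans mM _.
have cS : compact (lin_image A' K) by exact: lin_image_compact.
have S0 := lin_image_nonempty A' (body_nonempty bK).
have rp := inradius_gt0 bK uA'.
have [->|Mn0] := eqVneq M 0; first by rewrite mul0r divr_ge0 ?diameter_ge0 ?mulr_ge0// ltW.
have Mp : 0 < M by rewrite lt_def Mn0 M1.
suff h : M * inradius (lin_image A' K) <= diameter (lin_image A' K).
  by rewrite ler_pdivlMr ?mulr_gt0//; lra.
apply: inradius_mul_le => //; first exact: diameter_ge0.
move=> r c' r1 rS; set D' := diameter _.
rewrite -ler_pdivlMr//.
have [DM|/ltW DM] := leP (D' / r) M0; last exact: le_trans M2 DM.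
pose Z : T := ((invmx A' *m c', r *: invmx A'), (r^-1 *: A', D' / r)).
apply: (Mmin Z); rewrite /X /Z /=; split; last split; last split.
- move=> _ [x + <-]; rewrite eball0E => x1.
  have : lin_image A' K (c' + r *: x).
    apply: rS; rewrite eballE addrAC subrr add0r enormZ gtr0_norm//.
    by rewrite ler_piMr// ltW.
  by move=> /(lin_imageE _ _ uA'); rewrite mulmxDr -scalemxAr -scalemxAl.
- by rewrite -scalemxAl -scalemxAr scalerA mulVf ?gt_eqF// scale1r mulmxV.
- move=> x Kx y Ky; rewrite -scalemxAl enormZ gtr0_norm ?invr_gt0// mulrC.
  rewrite ler_pM2r ?invr_gt0// mulmxBr; apply: diameter_ub => //; by [exists x|exists y].
- by rewrite DM divr_ge0 ?diameter_ge0// ltW.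
Qed.

End Functionals.

(** * Upper bound *)

Section Upper.
Context {R : realType}.

(** The competitor is the linear part of the affine map taking the John ellipsoid
    to the unit ball. *)
Lemma ratio_upper_bound n (K : set 'cV[R]_n) : (0 < n)%N -> convex_body K ->
  exists2 m, diam_inradius_ratios K m & m <= upper_bound n (john_asymmetry K).
Proof.
move=> n0 bK; have [A uA JK] := john_position_preim bK.
have [s1 sn Ks] := john_asymmetry_spec n0 uA JK.
set s := john_asymmetry K in s1 sn Ks *; set c := john_center K in JK Ks *.
have [_ _ BK' _] := JK.
have uB : invmx A \in unitmx by rewrite unitmx_inv.
exists (diameter (lin_image (invmx A) K) / (2 * inradius (lin_image (invmx A) K))).
  by exists (invmx A).
have -> : upper_bound n s = 2 * upper_bound n s / 2 by field.
apply: (@ratio_le _ _ n0 K (invmx A) (invmx A *m c)) => //.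
  move=> x; rewrite eballE => xc.
  have /BK' : eball 0 1 (x - invmx A *m c) by rewrite eball0E.
  rewrite /affine_preim /= mulmxBr mulKVmx// addrC subrK => Kx.
  by exists (A *m x); rewrite ?mulKmx.
have pre x : K x -> affine_preim c A K (invmx A *m (x - c)).
  by move=> Kx; rewrite /affine_preim /= mulKVmx// addrC subrK.
move=> x y Kx Ky.
have -> : invmx A *m (x - y) = invmx A *m (x - c) - invmx A *m (y - c).
  by rewrite -mulmxBr opprB addrA subrK.
rewrite /upper_bound; case: eqVneq => [n2|n2].
  have -> : 2 * (Dconst s / 2) = Dconst s by field.
  move: (pre _ Kx) (pre _ Ky) Ks JK sn; move: (invmx A *m (x - c)) (invmx A *m (y - c)).
  move: (affine_preim c A K); clear -n2 s1; move: s1; move: s => s s1; subst n.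
  by move=> K' a b Ka Kb Ks JK s2; apply: john_position_diam2 Ka Kb => //; rewrite s1.
apply: le_trans (john_position_diam n0 JK _ Ks (pre _ Kx) (pre _ Ky)) _; first lra.
have -> : 2 * n%:R * (s + 1) = 2 ^+ 2 * (n%:R * (s + 1) / 2) by field.
by rewrite sqrtrM ?sqr_ge0// sqrtr_sqr ger0_norm.
Qed.

Lemma mink_le_john n (K : set 'cV[R]_n) : (0 < n)%N -> convex_body K ->
  minkowski_asymmetry K <= john_asymmetry K.
Proof.
move=> n0 bK; have [A uA JK] := john_position_preim bK.
have [s1 sn Ks] := john_asymmetry_spec n0 uA JK.
set s := john_asymmetry K in s1 sn Ks *; set c := john_center K in JK Ks *.
apply: mink_le; split; first lra.
exists ((s + 1) *: c) => _ [x Kx <-].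
have : affine_preim c A K (- (s^-1 *: (invmx A *m (x - c)))).
  by apply: Ks; rewrite /affine_preim /= mulKVmx// addrC subrK.
rewrite /affine_preim /= mulmxN -scalemxAr mulKVmx// => Kz.
exists (c - s^-1 *: (x - c)) => //.
by apply/matrixP => i j; rewrite !mxE; field; rewrite gt_eqF//; lra.
Qed.

Lemma john_asymmetry_le_dim n (K : set 'cV[R]_n) : (0 < n)%N -> convex_body K ->
  john_asymmetry K <= n%:R.
Proof.
move=> n0 bK; have [A uA JK] := john_position_preim bK.
by have [_ sn _] := john_asymmetry_spec n0 uA JK.
Qed.

(** If the John ellipsoid had a centre [c <> 0], the convex hull of it and its
    reflection through the origin would contain the ellipsoid centred at the
    origin and stretched by [1 + |b|] in the direction [b] of [c], in the
    coordinates where the John ellipsoid is a unit ball. *)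
Lemma john_center_symmetric n (K : set 'cV[R]_n) : convex_body K ->
  (forall x, K x -> K (- x)) -> john_center K = 0.
Proof.
move=> bK symK; have [A uA [_ vK BK Kmax]] := john_position_preim bK.
set c := john_center K in vK BK Kmax *.
have [_ /convex_setP cvK _] := bK.
pose b := invmx A *m c; have cE : c = A *m b by rewrite mulKVmx.
have [b0|b0] := eqVneq b 0; first by rewrite cE b0 mulmx0.
have bp : 0 < enorm b by rewrite enorm_gt0.
pose E : 'M[R]_n := 1%:M + ((enorm b)^-1 *: b) *m b^T.
have detE : \det E = 1 + enorm b.
  by rewrite /E det_rank1 dotZr -enorm_sq expr2 mulKf// gt_eqF.
have EK : ellipsoid (- b) E `<=` affine_preim c A K.
  move=> _ [v + <-]; rewrite eball0E => v1.
  pose t := dot b v / enorm b.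
  have t1 : `|t| <= 1.
    rewrite normrM normfV (gtr0_norm bp) ler_pdivrMr// mul1r.
    by apply: le_trans (dot_abs_le _ _) _; rewrite ler_piMr// enorm_ge0.
  have Kp : K (c + A *m v) by apply: BK; rewrite eball0E.
  have Km : K (- c + A *m v).
    have : K (c + A *m (- v)) by apply: BK; rewrite eball0E enormN.
    by move=> /symK; rewrite opprD mulmxN opprK.
  have := cvK _ _ ((1 + t) / 2) Kp Km.
  have -> : ((1 + t) / 2) *: (c + A *m v) + (1 - (1 + t) / 2) *: (- c + A *m v) =
    c + A *m (- b + E *m v).
    rewrite /E mulmxDl mul1mx mulmx_dot scalerA mulmxDr mulmxN -cE mulmxDr -scalemxAr -cE.
    have -> : dot b v * (enorm b)^-1 = t by [].
    by apply/matrixP => i j; rewrite !mxE; field.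
  by apply; move: t1; rewrite ler_norml => /andP[? ?]; apply/andP; split; lra.
have uE : E \in unitmx by rewrite unitmxE unitfE detE gt_eqF// addr_gt0.
by exfalso; have := Kmax _ _ uE EK; rewrite detE ger0_norm; lra.
Qed.

Lemma upper_lower_dim n : (0 < n)%N -> upper_bound n (n%:R : R) = lower_bound n n%:R.
Proof.
move=> n0; have nR : 0 < n%:R :> R by rewrite ltr0n.
have n1 : 1 <= n%:R :> R by rewrite ler1n.
have -> : lower_bound n (n%:R : R) = Num.sqrt (n%:R * (n%:R + 1) / 2).
  have E : n%:R * Num.sqrt ((n%:R + 1) / (2 * n%:R)) = Num.sqrt (n%:R * (n%:R + 1) / 2) :> R.
    have -> : n%:R * (n%:R + 1) / 2 = n%:R ^+ 2 * ((n%:R + 1) / (2 * n%:R)) :> R.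
      by field; rewrite gt_eqF.
    by rewrite [RHS]sqrtrM ?sqr_ge0// sqrtr_sqr ger0_norm// ltW.
  rewrite /lower_bound E; apply/max_idPl.
  rewrite -[X in X <= _]ger0_norm; last lra.
  by rewrite -sqrtr_sqr ler_wsqrtr//; nra.
rewrite /upper_bound; case: eqVneq => // ->.
rewrite /Dconst subrr expr0n mulr0 add0r sqrtr_sqr ger0_norm; last lra.
have -> : 2 ^+ 2 + 5 + (2 ^+ 2 - 1) = 2 ^+ 2 * (2 * (2 + 1) / 2) :> R by field.
by rewrite sqrtrM ?sqr_ge0// sqrtr_sqr ger0_norm//; field.
Qed.

Lemma upper_bound1 n : upper_bound n (1 : R) = Num.sqrt n%:R.
Proof.
rewrite /upper_bound; case: eqVneq => [->|_]; last by congr Num.sqrt; field.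
rewrite /Dconst expr1n subrr expr0n addr0.
have -> : 4 * (2 - 1) ^+ 2 = 2 ^+ 2 :> R by ring.
rewrite sqrtr_sqr ger0_norm//.
have -> : 1 + 5 + 2 = 2 ^+ 2 * 2 :> R by ring.
by rewrite sqrtrM ?sqr_ge0// sqrtr_sqr ger0_norm//; field.
Qed.

End Upper.

(** * Bodies attaining the lower bound *)

Section Simplex.
Context {R : realType}.
Context {n : nat}.
Context (n0 : (0 < n)%N).

(** The vertices of a regular simplex inscribed in the unit sphere: all but one
    are the basis vectors, rescaled and shifted along the diagonal. *)
Lemma regular_simplex : exists v : 'I_n.+1 -> 'cV[R]_n,
  [/\ forall i, dot (v i) (v i) = 1,
      forall i j, i != j -> dot (v i) (v j) = - n%:R^-1 & \sum_i v i = 0].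
Proof.
have nR : 0 < n%:R :> R by rewrite ltr0n.
pose r : R := Num.sqrt n%:R.
have rp : 0 < r by rewrite sqrtr_gt0.
have rr : r ^+ 2 = n%:R by rewrite sqr_sqrtr// ltW.
pose a : R := Num.sqrt ((n%:R + 1) / n%:R).
have aa : a ^+ 2 = (n%:R + 1) / n%:R by rewrite sqr_sqrtr// divr_ge0// ?addr_ge0// ltW.
pose b : R := (r^-1 - a) / n%:R.
pose one : 'cV[R]_n := const_mx 1.
pose e (k : nat) : 'cV[R]_n := \col_j ((j : nat) == k)%:R.
have d11 : dot one one = n%:R.
  rewrite /dot; under eq_bigr do rewrite !mxE mulr1.
  by rewrite sumr_const card_ord.
have de1 k : (k < n)%N -> dot (e k) one = 1.
  move=> kn; rewrite /dot (bigD1 (Ordinal kn))//= !mxE eqxx mulr1 big1 ?addr0//.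
  move=> i ik; rewrite !mxE mulr1; case: eqP => // ikE.
  by move/eqP: ik; case; apply/val_inj.
have dee k l : (k < n)%N -> dot (e k) (e l) = (k == l)%:R.
  move=> kn; rewrite /dot (bigD1 (Ordinal kn))//= !mxE eqxx mul1r big1 ?addr0//.
  move=> i ik; rewrite !mxE; case: eqP => [ikE|_]; last by rewrite mul0r.
  by move/eqP: ik; case; apply/val_inj.
pose f k : 'cV[R]_n := if (k < n)%N then a *: e k + b *: one else - r^-1 *: one.
have rn : r^-1 ^+ 2 = n%:R^-1 by rewrite exprVn rr.
have key : 2 * a * b + n%:R * b ^+ 2 = - n%:R^-1.
  have -> : 2 * a * b + n%:R * b ^+ 2 = (r^-1 ^+ 2 - a ^+ 2) / n%:R.
    by rewrite /b; field; rewrite !gt_eqF.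
  by rewrite rn aa; field; rewrite gt_eqF.
have key2 : a + n%:R * b = r^-1.
  by rewrite /b; field; rewrite !gt_eqF.
have fE k l : (k < n)%N -> (l < n)%N -> dot (f k) (f l) = a ^+ 2 * (k == l)%:R - n%:R^-1.
  move=> kn ln; rewrite /f kn ln !dotDl !dotDr !dotZl !dotZr dee// de1// (dotC one) de1// d11.
  by rewrite -key; ring.
have fn k : (k < n)%N -> dot (f k) (f n) = - n%:R^-1.
  move=> kn; rewrite /f kn ltnn !dotDl !dotZl !dotZr de1// d11.
  have -> : a * (- r^-1 * 1) + b * (- r^-1 * n%:R) = - (r^-1 * (a + n%:R * b)) by ring.
  by rewrite key2 -expr2 rn.
exists (fun i => f i); split.
- move=> i; have := ltn_ord i; rewrite ltnS leq_eqVlt => /predU1P[->|iN].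
    rewrite /f ltnn dotZl dotZr d11 mulrA -expr2 sqrrN rn mulVf// gt_eqF//.
  by rewrite fE// eqxx mulr1 aa; field; rewrite gt_eqF.
- move=> i j ij.
  have ij' : (i : nat) != j by [].
  have := ltn_ord i; rewrite ltnS leq_eqVlt => /predU1P[iE|iN].
    have := ltn_ord j; rewrite ltnS leq_eqVlt => /predU1P[jE|jN].
      by rewrite iE jE eqxx in ij'.
    by rewrite iE dotC fn.
  have := ltn_ord j; rewrite ltnS leq_eqVlt => /predU1P[jE|jN].
    by rewrite jE fn.
  by rewrite fE// (negbTE ij') mulr0 add0r.
- rewrite big_ord_recr /=; under eq_bigr do rewrite /f ltn_ord.
  rewrite /f ltnn big_split /= -scaler_sumr sumr_const card_ord.
  have -> : \sum_(i < n) e i = one.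
    apply/matrixP => i j; rewrite summxE mxE (bigD1 i)//= !mxE eqxx big1 ?addr0//.
    by move=> k ki; rewrite mxE; case: eqP => // /val_inj ik; rewrite ik eqxx in ki.
  rewrite -scaler_nat scalerA -scalerDl -scalerDl key2 addrN scale0r.
  by [].
Qed.

(** The body is the convex hull of the unit ball and of the regular simplex with
    circumradius [s], described by its support function: [h] is an upper bound
    for the maximum of [|u|] and the [<s v i, u>].  Its diameter is the largest
    distance between generators, [max (2, s + 1, s |v i - v j|)], which is twice
    the lower bound, and its Minkowski asymmetry is [s] because it lies between
    the unit ball and the ball of radius [s] and satisfies [<z, v i> >= - 1]. *)
Lemma tight_lower_body (s : R) : 1 <= s <= n%:R ->
  exists K : set 'cV[R]_n,
    [/\ convex_body K, minkowski_asymmetry K = s &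
      is_minimum (diam_inradius_ratios K) (lower_bound n (minkowski_asymmetry K))].
Proof.
move=> /andP[s1 sn]; have nR : 0 < n%:R :> R by rewrite ltr0n.
have sp : 0 < s by lra.
have [v [vv vij vsum]] := regular_simplex.
have v1 i : enorm (v i) = 1 by rewrite enormE vv sqrtr1.
pose K : set 'cV[R]_n := [set x | forall u, setT u -> forall h,
  (enorm u <= h /\ forall i, s * dot (v i) u <= h) -> dot x u <= h].
have ballK : eball 0 1 `<=` K.
  move=> x; rewrite eball0E => x1 u _ h [uh _].
  apply: le_trans (dot_le _ _) _; apply: le_trans uh.
  by rewrite ler_piMl// enorm_ge0.
have vK i : K (s *: v i) by move=> u _ h [_ /(_ i)]; rewrite dotZl.
have Ks x : K x -> enorm x <= s.
  move=> Kx; have [->|x0] := eqVneq x 0; first by rewrite enorm0 ltW.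
  have xp : 0 < enorm x by rewrite enorm_gt0.
  have := Kx ((enorm x)^-1 *: x) I s.
  rewrite dotZr -enorm_sq expr2 mulKf ?gt_eqF//; apply.
  rewrite enorm_normalize//; split=> // i.
  rewrite ler_piMr ?(ltW sp)//; apply: le_trans (dot_le _ _) _.
  by rewrite v1 enorm_normalize// mulr1.
have bK : convex_body K.
  split.
  - apply: (@enorm_bounded_compact _ _ s) => //.
    apply: (@closed_forall _ _ (fun u (x : 'cV[R]_n) => forall h,
      (enorm u <= h /\ forall i, s * dot (v i) u <= h) -> dot x u <= h)) => u _.
    apply: (@closed_forall _ _ (fun h (x : 'cV[R]_n) => dot x u <= h)) => h _.
    by apply: closed_cts_le; [apply: dot_cts; [exact: id_cts|exact: cst_cts]|exact: cst_cts].
  - apply/convex_setP => x y t Kx Ky /andP[t0 t1] u _ h uh.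
    rewrite dotDl !dotZl.
    have := ler_wpM2l t0 (Kx u I h uh).
    have := @ler_wpM2l _ (1 - t) _ _ _ (Ky u I h uh).
    by rewrite subr_ge0 => /(_ t1); lra.
  - by exists 0; apply: eball_interior ballK.
have mK : minkowski_asymmetry K = s.
  apply/eqP; rewrite eq_le; apply/andP; split.
    apply: mink_le; split; first exact: ltW.
    exists 0 => _ [x Kx <-]; exists (- (s^-1 *: x)).
      apply: ballK; rewrite eball0E enormN enormZ gtr0_norm ?invr_gt0//.
      by rewrite ler_pdivrMl// mulr1 Ks.
    by rewrite scalerN scalerA divff ?gt_eqF// scale1r addr0.
  apply: lb_le_inf; first exact: mink_feasible_ex.
  move=> rho [rho0 [t Ht]].
  (* the vertices [s v i] are sent by [- x + t] to points of [rho K] *)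
  have step i : - s + dot t (v i) >= - rho.
    have [z Kz zE] : [set rho *: x | x in K] (- (s *: v i) + t) by apply: Ht; exists (s *: v i).
    have zv : dot z (- v i) <= 1.
      apply: Kz => //; rewrite enormN v1; split=> // j; rewrite dotNr.
      have [->|ji] := eqVneq j i; first by rewrite vv; lra.
      by rewrite vij// opprK ler_pdivrMr// mul1r.
    have := congr1 (fun a : 'cV[R]_n => dot a (v i)) zE; rewrite !dotE vv => E.
    have : rho * dot z (- v i) <= rho * 1 by rewrite ler_wpM2l.
    by rewrite dotNr; lra.
  have : \sum_(i < n.+1) - rho <= \sum_(i < n.+1) (- s + dot t (v i)).
    by apply: ler_sum => i _; exact: step.
  rewrite big_split /= -dot_sumr vsum dot0r addr0 !sumr_const card_ord.
  by rewrite lerMn2r /= lerN2.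
exists K; split=> //; split; last exact: ratio_ge_lower_bound.
have lbl := ratio_ge_lower_bound n0 bK.
set L := lower_bound _ _ in lbl *.
have i1 : lin_image 1%:M K = K by exact: lin_image1.
pose m := diameter (lin_image 1%:M K) / (2 * inradius (lin_image 1%:M K)).
have Sm : diam_inradius_ratios K m by exists 1%:M => //; exact: unitmx1.
suff -> : L = m by [].
apply/eqP; rewrite eq_le lbl//=.
have -> : L = 2 * L / 2 by field.
apply: (@ratio_le _ _ n0 K 1%:M 0) => //; [exact: unitmx1|by rewrite i1|].
move=> x y Kx Ky; rewrite mul1mx.
have Ls : s + 1 <= 2 * L.
  have : (s + 1) / 2 <= L by rewrite /L mK /lower_bound le_max lexx orbT.
  lra.
have Lv i j u : enorm u = 1 -> s * (dot (v i) u - dot (v j) u) <= 2 * L.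
  move=> u1; have : s * Num.sqrt ((n%:R + 1) / (2 * n%:R)) <= L.
    by rewrite /L mK /lower_bound le_max lexx.
  move=> h; apply: (@le_trans _ _ (2 * (s * Num.sqrt ((n%:R + 1) / (2 * n%:R))))); last lra.
  rewrite mulrCA ler_pM2l//.
  have -> : dot (v i) u - dot (v j) u = dot (v i - v j) u by rewrite dotDl dotNl.
  apply: le_trans (dot_le _ _) _; rewrite u1 mulr1 enorm_le; last by rewrite mulr_ge0// sqrtr_ge0.
  rewrite exprMn sqr_sqrtr; last by rewrite divr_ge0 ?addr_ge0 ?mulr_ge0// ltW.
  have -> : 2 ^+ 2 * ((n%:R + 1) / (2 * n%:R)) = 2 + 2 * n%:R^-1 :> R by field; rewrite gt_eqF.
  have [->|ij] := eqVneq i j.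
    by rewrite subrr dot0l addr_ge0// mulr_ge0// invr_ge0 ltW.
  by rewrite dotDl !dotDr !dotNl !dotNr !vv (dotC (v j)) vij//; lra.
have [xy|xy] := eqVneq x y; first by rewrite xy subrr enorm0; lra.
have xy0 : x - y != 0 by rewrite subr_eq0.
pose u := (enorm (x - y))^-1 *: (x - y).
have u1 : enorm u = 1 by exact: enorm_normalize.
have vu i w : enorm w = 1 -> dot (v i) w <= 1.
  by move=> w1; apply: le_trans (dot_le _ _) _; rewrite v1 w1 mulr1.
(* the support inequality is used for [x], and within it for [y] *)
have xu_le : dot x u <= 2 * L - dot y (- u).
  apply: Kx => //; split.
    rewrite u1 lerBrDr -lerBrDl; apply: Ky => //; rewrite enormN u1; split; first lra.
    move=> i; have : s * dot (v i) (- u) <= s * 1 by rewrite ler_pM2l// vu// enormN.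
    lra.
  move=> i; rewrite lerBrDr -lerBrDl; apply: Ky => //; rewrite enormN u1; split.
    have : s * dot (v i) u <= s * 1 by rewrite ler_pM2l// vu.
    lra.
  by move=> j; have := Lv i j u u1; rewrite dotNr; lra.
have : dot (x - y) u = enorm (x - y).
  by rewrite dotZr -enorm_sq expr2 mulKf// enorm_eq0.
rewrite dotDl dotNl; rewrite dotNr in xu_le; lra.
Qed.

End Simplex.

(** * The cube *)

Section Cube.
Context {R : realType}.

(** Choose the signs one after the other: at least one of [|w + a| ^ 2] and
    [|w - a| ^ 2] is at least [|w| ^ 2 + |a| ^ 2]. *)
Lemma sign_sum n m (a : 'I_m -> 'cV[R]_n) (r : seq 'I_m) : uniq r ->
  exists2 e : 'I_m -> R, forall i, `|e i| = 1 &
    \sum_(i <- r) dot (a i) (a i) <=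
    dot (\sum_(i <- r) e i *: a i) (\sum_(i <- r) e i *: a i).
Proof.
elim: r => [|k r IH] /=.
  by exists (fun=> 1); [move=> i; rewrite normr1|rewrite !big_nil dot0l].
move=> /andP[kr ur]; have [e e1 er] := IH ur.
set w := \sum_(i <- r) e i *: a i in er.
have [s s1 ws] : exists2 s : R, `|s| = 1 & 0 <= s * dot (a k) w.
  have [h|/ltW h] := leP 0 (dot (a k) w); first by exists 1; rewrite ?normr1 ?mul1r.
  by exists (-1); rewrite ?normrN1 ?mulN1r ?oppr_ge0.
exists (fun i => if i == k then s else e i); first by move=> i; case: ifP.
rewrite !big_cons eqxx.
have -> : \sum_(j <- r) (if j == k then s else e j) *: a j = w.
  apply: eq_big_seq => i ir; case: eqP => // ik; by rewrite ik in ir; rewrite ir in kr.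
have ss : s ^+ 2 = 1 by rewrite -[s ^+ 2]real_normK ?num_real// s1 expr1n.
clearbody w; rewrite !dotDl !dotDr !dotZl !dotZr (dotC w) mulrA -expr2 ss; lra.
Qed.

Definition cube n : set 'cV[R]_n := [set x | forall i j, `|x i j| <= 1].

Lemma cube_ball n : eball 0 1 `<=` @cube n.
Proof.
by move=> x; rewrite eball0E => x1 i j; rewrite ord1 (le_trans (enorm_coord _ _)).
Qed.

Lemma cube_body n : convex_body (@cube n).
Proof.
split.
- exact: mx_entries_compact.
- apply/convex_setP => x y t Kx Ky /andP[t0 t1] i j; rewrite !mxE.
  have d0 : 0 <= 1 - t by rewrite subr_ge0.
  apply: le_trans (ler_normD _ _) _; rewrite !normrM (ger0_norm t0) (ger0_norm d0).
  by have := ler_wpM2l t0 (Kx i j); have := ler_wpM2l d0 (Ky i j); lra.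
- by exists 0; apply: (eball_interior ltr01); exact: cube_ball.
Qed.

Lemma cube_john_asymmetry n : (0 < n)%N -> john_asymmetry (@cube n) = 1.
Proof.
move=> n0; have bK := cube_body n.
have symK x : @cube n x -> cube (- x) by move=> Kx i j; rewrite mxE normrN.
have [A uA JK] := john_position_preim bK.
have [s1 _ _] := john_asymmetry_spec n0 uA JK.
apply/eqP; rewrite eq_le s1 andbT; apply: ge_inf; first by exists 0 => x [].
split=> // _ [x Kx <-]; rewrite john_center_symmetric//.
by exists (- x); [exact: symK|rewrite scale1r opprK subr0 add0r].
Qed.

(** Let [a i] be the columns of [A] and [g i] the rows of its inverse.  A ball of
    radius [r] between the facets [<g i, x> = +- 1] forces [r |g i| <= 1], hence
    [r <= |a i|] since [<g i, a i> = 1].  A suitable vertex of [A K] has squared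
    norm at least the sum of the [|a i| ^ 2]. *)
Lemma cube_ball_diameter n (A : 'M[R]_n) c r : (0 < n)%N -> A \in unitmx -> 0 < r ->
  eball c r `<=` lin_image A (@cube n) ->
  2 * Num.sqrt n%:R * r <= diameter (lin_image A (@cube n)).
Proof.
move=> n0 uA r0 rS; set S := lin_image A _ in rS *.
have [cK _ _] := cube_body n.
have cS : compact S by exact: lin_image_compact.
pose a i := col i A; pose g i := (row i (invmx A))^T.
have ga i : dot (g i) (a i) = 1.
  have := mulVmx uA => /matrixP/(_ i i); rewrite !mxE eqxx mulr1n => <-.
  by apply: eq_bigr => k _; rewrite !mxE.
have gi i x : (invmx A *m x) i 0 = dot (g i) x.
  by rewrite mxE; apply: eq_bigr => k _; rewrite !mxE.
have gr i : r * enorm (g i) <= 1.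
  have gp : 0 < enorm (g i).
    rewrite enorm_gt0; apply/eqP => g0; have := ga i; rewrite g0 dot0l => /eqP.
    by rewrite eq_sym oner_eq0.
  pose h := (r / enorm (g i)) *: g i.
  have hr : enorm h = r by rewrite enormZ gtr0_norm ?divr_gt0// divfK// gt_eqF.
  have gh : dot (g i) h = r * enorm (g i).
    by rewrite dotZr -enorm_sq; field; rewrite gt_eqF.
  have : cube (invmx A *m (c + h)).
    by apply/lin_imageE => //; apply: rS; rewrite eballE addrAC subrr add0r hr.
  move=> /(_ i 0); rewrite gi dotDr gh ler_norml => /andP[_ h1].
  have : cube (invmx A *m (c - h)).
    by apply/lin_imageE => //; apply: rS; rewrite eballE addrAC subrr add0r enormN hr.
  move=> /(_ i 0); rewrite gi dotDr dotNr gh ler_norml => /andP[h2 _].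
  lra.
have ra i : r ^+ 2 <= dot (a i) (a i).
  rewrite -enorm_sq ler_sqr ?nnegrE ?enorm_ge0 ?(ltW r0)//.
  have h1 : r * 1 <= r * (enorm (g i) * enorm (a i)).
    by rewrite ler_pM2l// -(ga i) dot_le.
  have h2 : r * enorm (g i) * enorm (a i) <= 1 * enorm (a i).
    by rewrite ler_wpM2r// enorm_ge0.
  lra.
have [e e1 He] := sign_sum a (index_enum_uniq 'I_n).
set w := (\sum_(i <- _) e i *: a i) in He.
pose x : 'cV[R]_n := \col_i e i.
have wE : A *m x = w.
  apply/matrixP => k l; rewrite mxE /w summxE; apply: eq_bigr => i _.
  by rewrite !mxE mulrC.
have Sw : S w by exists x => //; move=> i j; rewrite mxE e1.
have SNw : S (- w).
  by exists (- x); [move=> i j; rewrite !mxE normrN e1|rewrite mulmxN wE].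
have := diameter_ub cS Sw SNw.
have -> : w - - w = 2 *: w by rewrite opprK -mulr2n -scaler_nat.
rewrite enormZ ger0_norm// => wD; apply: le_trans wD.
rewrite -mulrA ler_pM2l// enormE -[r]gtr0_norm// -sqrtr_sqr -sqrtrM//.
apply: ler_wsqrtr; apply: le_trans He.
have -> : n%:R * r ^+ 2 = \sum_(i < n) r ^+ 2 by rewrite sumr_const card_ord mulr_natl.
by apply: ler_sum => i _; exact: ra.
Qed.

Lemma tight_upper_cube n : (0 < n)%N ->
  is_minimum (diam_inradius_ratios (@cube n)) (upper_bound n 1).
Proof.
move=> n0; have bK := cube_body n; have [cK _ _] := bK.
rewrite upper_bound1.
have nR : 0 < n%:R :> R by rewrite ltr0n.
have q0 : 0 < Num.sqrt n%:R :> R by rewrite sqrtr_gt0.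
have lb : lbound (diam_inradius_ratios (@cube n)) (Num.sqrt n%:R).
  move=> _ [A uA <-].
  have cS : compact (lin_image A (@cube n)) by exact: lin_image_compact.
  have S0 := lin_image_nonempty A (body_nonempty bK).
  have r0 := inradius_gt0 n0 bK uA.
  rewrite ler_pdivlMr ?mulr_gt0// mulrCA mulrA.
  apply: inradius_mul_le => //; first by rewrite mulr_gt0.
    exact: diameter_ge0.
  by move=> r c rp rS; exact: cube_ball_diameter rS.
split=> //.
pose m := diameter (lin_image 1%:M (@cube n)) / (2 * inradius (lin_image 1%:M (@cube n))).
have Sm : diam_inradius_ratios (@cube n) m by exists 1%:M => //; exact: unitmx1.
suff -> : Num.sqrt n%:R = m by [].
apply/eqP; rewrite eq_le lb//=.
have -> : Num.sqrt n%:R = 2 * Num.sqrt n%:R / 2 :> R by field.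
apply: (@ratio_le _ _ n0 _ 1%:M 0) => //; [exact: unitmx1|by rewrite lin_image1;
  exact: cube_ball|].
move=> x y Kx Ky; rewrite mul1mx enorm_le ?mulr_ge0 ?(ltW q0)//.
rewrite exprMn sqr_sqrtr ?(ltW nR)//.
have -> : 2 ^+ 2 * n%:R = \sum_(i < n) 2 ^+ 2 :> R by rewrite sumr_const card_ord mulr_natr.
apply: ler_sum => i _; rewrite -expr2 !mxE -[X in X <= _]real_normK ?num_real//.
rewrite ler_sqr ?nnegrE//; apply: le_trans (ler_normD _ _) _; rewrite normrN.
by have := Kx i 0; have := Ky i 0; lra.
Qed.

End Cube.

Theorem corollary5p4 (R : realType) (n : nat) (n_gt0 : (0 < n)%N) :
  (forall K : set 'cV[R]_n, convex_body K ->
     exists m : R,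
       [/\ is_minimum (diam_inradius_ratios K) m,
           lower_bound n (minkowski_asymmetry K) <= m &
           m <= upper_bound n (john_asymmetry K)]) /\
  (forall s : R, 1 <= s <= n%:R ->
     exists K : set 'cV[R]_n,
       [/\ convex_body K,
           minkowski_asymmetry K = s &
           is_minimum (diam_inradius_ratios K)
             (lower_bound n (minkowski_asymmetry K))]) /\
  (forall s : R, s = 1 \/ s = n%:R ->
     exists K : set 'cV[R]_n,
       [/\ convex_body K,
           john_asymmetry K = s &
           is_minimum (diam_inradius_ratios K)
             (upper_bound n (john_asymmetry K))]).
Proof.
split; last split.
- move=> K bK; have [m mmin] := ratio_min_exists n_gt0 bK.
  exists m; split=> //.
    exact: (ratio_ge_lower_bound n_gt0 bK mmin.1).
  have [m' Sm' m'u] := ratio_upper_bound n_gt0 bK.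
  exact: le_trans (mmin.2 _ Sm') m'u.
- by move=> s; exact: tight_lower_body.
- move=> s [->|->].
    exists (@cube R n); rewrite cube_john_asymmetry//; split=> //.
      exact: cube_body.
    exact: tight_upper_cube.
  have [K [bK mK minK]] : exists K : set 'cV[R]_n,
    [/\ convex_body K, minkowski_asymmetry K = n%:R &
      is_minimum (diam_inradius_ratios K) (lower_bound n (minkowski_asymmetry K))].
    by apply: tight_lower_body => //; rewrite ler1n n_gt0 lexx.
  have jK : john_asymmetry K = n%:R.
    apply/eqP; rewrite eq_le john_asymmetry_le_dim//=.
    by rewrite -{1}mK mink_le_john.
  by exists K; rewrite jK upper_lower_dim// -mK.
Qed.
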